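(* Let $\mathcal{S}$ be a Steiner tree for terminals $A=(a_1,\dots,a_n)$, $a_i\in\mathbb{R}^d$, and let $r>0$ be such that every Steiner tree for every $n$-tuple in the closed $2r$-neighbourhood of $A$ (with respect to the Chebyshev distance $\rho$) has the same topology as $\mathcal{S}$. Then there exists an $n$-tuple of points $M$ in $\mathbb{R}^d$ such that $\mathcal{S}$ is an $r$-minimizer for $M$.
   Context: $\mathcal{H}^1$ is the one-dimensional Hausdorff measure. For a compact set $M\subset\mathbb{R}^d$ and $r>0$, an $r$-minimizer for $M$ is a connected compact set $\Sigma\subset\mathbb{R}^d$ that has the minimal length $\mathcal{H}^1(\Sigma)$ among all connected compact sets satisfying $\max_{y\in M}\operatorname{dist}(y,\Sigma)\le r$. The Chebyshev distance between $n$-tuples $u=(u_1,\dots,u_n)$ and $v=(v_1,\dots,v_n)$ of points of $\mathbb{R}^d$ is $\rho(u,v)=\max_{1\le i\le n}|u_i-v_i|$. A Steiner tree for a finite set (or tuple) $P$ of points of $\mathbb{R}^d$ is a connected set containing $P$ of minimal $\mathcal{H}^1$-measure. It is known that it exists, is a finite union of segments, and can be represented as a tree (graph) embedded in $\mathbb{R}^d$ with straight line segments as edges, whose vertex set contains $P$; the vertices in $P$ are called terminals and all other vertices, called Steiner points, have degree $3$. The topology of a Steiner tree with labelled terminals is the corresponding abstract graph with labelled terminals (the terminal at the $i$-th point of the tuple has label $i$; if several points of the tuple coincide, the corresponding vertex carries all their labels) and unlabelled Steiner points. Two trees have the same topology if there is a graph isomorphism preserving the labels of terminals. *)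

(* Defs.v *)
From HB Require Import structures.
From mathcomp Require Import all_boot all_order all_algebra.
From mathcomp Require Import all_classical all_reals all_analysis.

Set Implicit Arguments.
Unset Strict Implicit.
Unset Printing Implicit Defensive.

Import Order.TTheory GRing.Theory Num.Theory.
Import numFieldNormedType.Exports.

Local Open Scope classical_set_scope.
Local Open Scope ring_scope.

(* Points of R^d are row vectors 'rV[R]_d.  The library norm on 'rV[R]_d is the
   sup norm, so the Euclidean distance is defined here; both induce the same
   topology, so the library [connected] and [compact] are the usual notions. *)
Definition edistance (R : realType) (d : nat) (x y : 'rV[R]_d) : R :=
  Num.sqrt (\sum_(j < d) (x 0 j - y 0 j) ^+ 2).

(* Since [ereal_sup set0] is -oo, the max with 0 makes the diameter of the
   empty set equal to 0. *)
Definition ediameter (R : realType) (d : nat) (U : set 'rV[R]_d) : \bar R :=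
  maxe 0%E (ereal_sup [set (edistance p.1 p.2)%:E | p in U `*` U]).

Definition hausdorff1_content (R : realType) (d : nat) (delta : R)
    (E : set 'rV[R]_d) : \bar R :=
  ereal_inf [set (\sum_(0 <= k <oo) ediameter (U k))%E
            | U in [set U : (set 'rV[R]_d)^nat |
                     E `<=` \bigcup_k U k
                     /\ forall k, (ediameter (U k) <= delta%:E)%E]].

(* The limit as delta tends to 0 is a supremum, by monotonicity in delta.  In
   dimension one the usual normalising constant of Hausdorff measure is 1, so
   that a segment has its Euclidean length. *)
Definition hausdorff1 (R : realType) (d : nat) (E : set 'rV[R]_d) : \bar R :=
  ereal_sup [set hausdorff1_content delta E | delta in [set delta : R | 0 < delta]].

(* Infinite when [E] is empty. *)
Definition dist_to_set (R : realType) (d : nat) (y : 'rV[R]_d)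
    (E : set 'rV[R]_d) : \bar R :=
  ereal_inf [set (edistance y x)%:E | x in E].

(* For compact nonempty [M] and nonempty [E] this supremum is a maximum. *)
Definition max_dist (R : realType) (d : nat) (M E : set 'rV[R]_d) : \bar R :=
  ereal_sup [set dist_to_set y E | y in M].

Definition r_admissible (R : realType) (d : nat) (r : R) (M E : set 'rV[R]_d) :
    Prop :=
  [/\ connected E, compact E & (max_dist M E <= r%:E)%E].

Definition r_minimizer (R : realType) (d : nat) (r : R) (M E : set 'rV[R]_d) :
    Prop :=
  r_admissible r M E
  /\ forall E' : set 'rV[R]_d,
       r_admissible r M E' -> (hausdorff1 E <= hausdorff1 E')%E.

(* The default value 0 is harmless: distances are nonnegative. *)
Definition chebyshev_dist (R : realType) (d n : nat) (u v : 'I_n -> 'rV[R]_d) : R :=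
  \big[Num.max/0]_(i < n) edistance (u i) (v i).

Definition steiner_tree (R : realType) (d n : nat) (A : 'I_n -> 'rV[R]_d)
    (S : set 'rV[R]_d) : Prop :=
  [/\ connected S, range A `<=` S &
      forall T : set 'rV[R]_d, connected T -> range A `<=` T ->
        (hausdorff1 S <= hausdorff1 T)%E].

(* [label i] is the vertex carrying the label i; a vertex may carry several
   labels, and the vertices outside the range of [label] are unlabelled. *)
Record labelled_graph (n : nat) := LabelledGraph {
  vertex : finType;
  edge : rel vertex;
  label : 'I_n -> vertex
}.

(* A cycle has at least three vertices: for a symmetric relation, [:: x; y] is
   a [ucycle] as soon as x and y are adjacent. *)
Definition is_tree (V : finType) (e : rel V) : Prop :=
  [/\ symmetric e, irreflexive e, (forall x y : V, connect e x y)
    & forall c : seq V, ucycle e c -> (size c <= 2)%N].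

Definition labelled_iso (n : nat) (G H : labelled_graph n) : Prop :=
  exists f : vertex G -> vertex H,
    [/\ bijective f,
        (forall x y : vertex G, edge (f x) (f y) = edge x y)
      & forall i : 'I_n, f (label G i) = label H i].

Definition segment (R : realType) (d : nat) (x y : 'rV[R]_d) : set 'rV[R]_d :=
  [set (1 - t) *: x + t *: y | t in [set t : R | 0 <= t <= 1]].

(* Two distinct straight edges may only meet at (the position of) a common
   endpoint.  The edges are unordered, whence the comparison up to [perm_eq]. *)
Definition straight_embedding (R : realType) (d : nat) (V : finType)
    (e : rel V) (pos : V -> 'rV[R]_d) : Prop :=
  injective pos
  /\ forall u v x y : V, e u v -> e x y ->
       ~~ perm_eq [:: u; v] [:: x; y] ->
       segment (pos u) (pos v) `&` segment (pos x) (pos y) `<=`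
         [set pos w | w in [set w | (w \in [:: u; v]) && (w \in [:: x; y])]].

(* The vertex positions are part of the union for the sake of the tree with a
   single vertex. *)
Definition drawing (R : realType) (d : nat) (V : finType) (e : rel V)
    (pos : V -> 'rV[R]_d) : set 'rV[R]_d :=
  range pos `|`
  \bigcup_(p in [set p : V * V | e p.1 p.2]) segment (pos p.1) (pos p.2).

(* [S] is drawn as the tree [G] with vertex positions [pos]: the vertex
   labelled i is at the i-th terminal, and the remaining vertices, the Steiner
   points, have degree 3. *)
Definition represents (R : realType) (d n : nat) (A : 'I_n -> 'rV[R]_d)
    (S : set 'rV[R]_d) (G : labelled_graph n) (pos : vertex G -> 'rV[R]_d) :
    Prop :=
  [/\ is_tree (@edge n G),
      straight_embedding (@edge n G) pos,
      S = drawing (@edge n G) pos,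
      (forall i : 'I_n, pos (label G i) = A i)
    & forall v : vertex G,
        (forall i : 'I_n, label G i <> v) -> #|edge v| = 3%N].

(* Topology of the tree [S] on the terminals [A].  The representation of a
   Steiner tree is unique: besides the terminals, its vertices are the branch
   points of [S]. *)
Definition has_topology (R : realType) (d n : nat) (A : 'I_n -> 'rV[R]_d)
    (S : set 'rV[R]_d) (G : labelled_graph n) : Prop :=
  exists pos : vertex G -> 'rV[R]_d, represents A S pos.

Definition same_topology (R : realType) (d n : nat)
    (A : 'I_n -> 'rV[R]_d) (S : set 'rV[R]_d)
    (B : 'I_n -> 'rV[R]_d) (T : set 'rV[R]_d) : Prop :=
  exists G H : labelled_graph n,
    [/\ has_topology A S G, has_topology B T H & labelled_iso G H].

(* Main.v *)
Require Import Defs.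
From HB Require Import structures.
From mathcomp Require Import all_boot all_order all_algebra.
From mathcomp Require Import all_classical all_reals all_analysis.
From mathcomp Require Import ring lra zify.
Set Implicit Arguments.
Unset Strict Implicit.
Unset Printing Implicit Defensive.

Import Order.TTheory GRing.Theory Num.Theory.
Import numFieldNormedType.Exports.

Local Open Scope classical_set_scope.
Local Open Scope ring_scope.

(** Write [g_v] for the sum of the unit vectors that point to a vertex [v] of
the tree [S] from its neighbours. This is the gradient of the total length
with respect to the position of [v], and the length of a tree of fixed
topology is a convex function of all positions
([graph_length_convex]): new positions [p'] give at least the old length plus
the sum of the [g_v . (p'_v - p_v)]. Steiner points have [g_v = 0], because [S]
is minimal ([vertex_gradient_steiner]). Each terminal [a_i] is moved by [r] along
[g_i] to get [m_i = a_i + r g_i / |g_i|], with [m_i = a_i] if [g_i = 0].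

A competitor [E] contains points [b_i] at distance at most [r] from the [m_i].
Then [g_i . (b_i - a_i) = r |g_i| - g_i . (m_i - b_i) >= 0], and [b] is within
[2 r] of [a], so a Steiner tree [T] for [b] has the topology of [S] and, by
convexity, at least its length. Hence [E], being a connected set through [b],
is at least as long as [S].

Three facts make this rigorous for the Hausdorff measure.

Length and measure agree on embedded trees. Cutting the edges into short pieces
bounds the measure from above ([hausdorff1_segments_le]); since the edges
do not cross, a fine cover treats them separately, which bounds it from below
([hausdorff1_segments_ge]).

Steiner trees exist ([steiner_tree_exists]). A fine open cover of a connected
set contains chains that link all terminals, and polylines along these chains
are hardly longer than the cover allows ([net_add]). Straightening them leaves a
number of segments that depends only on the number of terminals
([spanning_le_hausdorff1]), and among such families of segments compactness
yields a shortest one ([min_spanning_exists]).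

The hypothesis yields, for every [b], some tree structure on [S], possibly
depending on [b], whereas the [m_i] must be chosen beforehand. But [g_i] is
read off the directions in which [S] leaves [a_i], so it is the same for all
these structures ([vertex_gradient_unique]). *)

(** * Euclidean geometry of row vectors *)

Section Euclid.
Variables (R : realType) (d : nat).
Implicit Types (x y z w : 'rV[R]_d) (t a b : R).

Definition dot x y : R := \sum_(j < d) x 0 j * y 0 j.

Definition enorm x : R := Num.sqrt (dot x x).

(** The direction of the zero vector is zero, since [0^-1 = 0]. *)
Definition udir x : 'rV[R]_d := (enorm x)^-1 *: x.

Lemma dotC x y : dot x y = dot y x.
Proof. by apply: eq_bigr => j _; rewrite mulrC. Qed.

Lemma dotDl x y z : dot (x + y) z = dot x z + dot y z.
Proof. by rewrite -big_split; apply: eq_bigr => j _; rewrite !mxE mulrDl. Qed.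

Lemma dotZl t x y : dot (t *: x) y = t * dot x y.
Proof. by rewrite mulr_sumr; apply: eq_bigr => j _; rewrite !mxE mulrA. Qed.

Lemma dotDr x y z : dot x (y + z) = dot x y + dot x z.
Proof. by rewrite dotC dotDl !(dotC x). Qed.

Lemma dotZr t x y : dot x (t *: y) = t * dot x y.
Proof. by rewrite dotC dotZl dotC. Qed.

Lemma dotNl x y : dot (- x) y = - dot x y.
Proof. by rewrite -scaleN1r dotZl mulN1r. Qed.

Lemma dotNr x y : dot x (- y) = - dot x y.
Proof. by rewrite dotC dotNl dotC. Qed.

Lemma dotBl x y z : dot (x - y) z = dot x z - dot y z.
Proof. by rewrite dotDl dotNl. Qed.

Lemma dotBr x y z : dot x (y - z) = dot x y - dot x z.
Proof. by rewrite dotDr dotNr. Qed.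

Lemma dot0l x : dot 0 x = 0.
Proof. by rewrite -(scale0r 0) dotZl mul0r. Qed.

Lemma dot_suml (I : Type) (s : seq I) (P : pred I) (F : I -> 'rV[R]_d) x :
  dot (\sum_(i <- s | P i) F i) x = \sum_(i <- s | P i) dot (F i) x.
Proof.
apply: (big_morph (fun u => dot u x) _ (dot0l x)) => u v.
exact: dotDl.
Qed.

Lemma dotxx_ge0 x : 0 <= dot x x.
Proof. by apply: sumr_ge0 => j _; rewrite -expr2 sqr_ge0. Qed.

Lemma enorm_ge0 x : 0 <= enorm x.
Proof. exact: sqrtr_ge0. Qed.

Lemma enorm_sqr x : enorm x ^+ 2 = dot x x.
Proof. by rewrite sqr_sqrtr// dotxx_ge0. Qed.

Lemma dotxx_eq0 x : (dot x x == 0) = (x == 0).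
Proof.
apply/eqP/eqP => [x0|->]; last exact: dot0l.
apply/rowP => j; rewrite mxE; apply/eqP.
have := psumr_eq0P (fun j _ => sqr_ge0 (x 0 j)) _ => /(_ xpredT) h.
by rewrite -sqrf_eq0 h// -[RHS]x0; apply: eq_bigr => i _; rewrite expr2.
Qed.

Lemma enorm_eq0 x : (enorm x == 0) = (x == 0).
Proof. by rewrite -sqrf_eq0 enorm_sqr dotxx_eq0. Qed.

Lemma enorm_gt0 x : (0 < enorm x) = (x != 0).
Proof. by rewrite lt0r enorm_ge0 enorm_eq0 andbT. Qed.

Lemma enorm0 : enorm 0 = 0.
Proof. by apply/eqP; rewrite enorm_eq0. Qed.

Lemma enormZ t x : enorm (t *: x) = `|t| * enorm x.
Proof.
by rewrite /enorm dotZl dotZr mulrA -expr2 sqrtrM ?sqr_ge0// sqrtr_sqr.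
Qed.

Lemma enormN x : enorm (- x) = enorm x.
Proof. by rewrite -scaleN1r enormZ normrN1 mul1r. Qed.

Lemma udirN x : udir (- x) = - udir x.
Proof. by rewrite /udir enormN scalerN. Qed.

Lemma udirZ a x : 0 < a -> udir (a *: x) = udir x.
Proof.
move=> a0; rewrite /udir enormZ gtr0_norm// scalerA invfM mulrAC mulVf ?mul1r//.
by rewrite gt_eqF.
Qed.

Lemma udir_dot x : dot (udir x) x = enorm x.
Proof.
rewrite dotZl -enorm_sqr; have [->|/mulVf h] := eqVneq (enorm x) 0.
  by rewrite expr2 !mulr0.
by rewrite expr2 mulrA h mul1r.
Qed.

(** Cauchy-Schwarz: with [u] the direction of [x], expanding
    [0 <= |y - (u.y) u|^2] and using [|u| <= 1] gives [(u.y)^2 <= |y|^2]. *)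
Lemma udir_dot_le x y : dot (udir x) y <= enorm y.
Proof.
set u := udir x; have u1 : dot u u <= 1.
  rewrite /u dotZr udir_dot; have [->|/mulVf->//] := eqVneq (enorm x) 0.
  by rewrite mulr0.
clearbody u; have := dotxx_ge0 (y - dot u y *: u).
rewrite dotBl !dotBr !dotZl !dotZr (dotC y u) => h.
apply: le_trans (ler_norm _) _; rewrite -sqrtr_sqr ler_sqrt ?dotxx_ge0//.
have := sqr_ge0 (dot u y); rewrite expr2 => h2.
have h3 : dot u y * dot u y * dot u u <= dot u y * dot u y by rewrite ler_piMr.
by rewrite mulrA in h; lra.
Qed.

Lemma dot_le x y : dot x y <= enorm x * enorm y.
Proof.
have [->|x0] := eqVneq x 0; first by rewrite dot0l enorm0 mul0r.
have ex : x = enorm x *: udir x.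
  by rewrite scalerA mulfV ?scale1r// enorm_eq0.
by rewrite {1}ex dotZl ler_wpM2l ?enorm_ge0// udir_dot_le.
Qed.

Lemma enormD x y : enorm (x + y) <= enorm x + enorm y.
Proof. by rewrite -udir_dot dotDr lerD// udir_dot_le. Qed.

(** The Euclidean norm lies below its tangent parabola: since
    [2 a b <= a^2 + b^2], [b = |x + t w|] is at most [(a^2 + b^2) / (2 a)] with
    [a = |x|], and this is the right-hand side expanded. *)
Lemma enorm_tangent x w t : x != 0 ->
  enorm (x + t *: w) <=
  enorm x + t * dot (udir x) w + t ^+ 2 * (dot w w / (2 * enorm x)).
Proof.
rewrite -enorm_gt0 => x0; set a := enorm x in x0 *; set b := enorm _.
have hb : b ^+ 2 = a ^+ 2 + 2 * t * dot x w + t ^+ 2 * dot w w.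
  rewrite /a /b !enorm_sqr dotDl !dotDr !dotZl !dotZr (dotC w x); ring.
rewrite dotZl -/a.
have -> : a + t * (a^-1 * dot x w) + t ^+ 2 * (dot w w / (2 * a)) =
          (a ^+ 2 + b ^+ 2) / (2 * a) by rewrite hb; field; rewrite gt_eqF.
rewrite ler_pdivlMr ?mulr_gt0//.
by have := sqr_ge0 (a - b); rewrite sqrrB; lra.
Qed.

Lemma edistanceE x y : edistance x y = enorm (x - y).
Proof.
by rewrite /edistance /enorm; congr Num.sqrt; apply: eq_bigr => j _; rewrite !mxE expr2.
Qed.

Lemma edistance_ge0 x y : 0 <= edistance x y.
Proof. by rewrite edistanceE enorm_ge0. Qed.

Lemma edistanceC x y : edistance x y = edistance y x.
Proof. by rewrite !edistanceE -opprB enormN. Qed.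

Lemma edistancexx x : edistance x x = 0.
Proof. by rewrite edistanceE subrr enorm0. Qed.

Lemma edistance_eq0 x y : (edistance x y == 0) = (x == y).
Proof. by rewrite edistanceE enorm_eq0 subr_eq0. Qed.

Lemma edistance_triangle y x z : edistance x z <= edistance x y + edistance y z.
Proof. by rewrite !edistanceE; apply: le_trans (enormD _ _); rewrite addrA subrK. Qed.

Lemma sum_continuous (T : topologicalType) (I : Type) (r : seq I)
    (f : I -> T -> R) :
  (forall i, continuous (f i)) -> continuous (fun s => \sum_(i <- r) f i s).
Proof.
move=> cf s; apply: (@cvg_big R I +%R 0 xpredT) => [|i _]; last exact: cf.
  by move=> z; apply: cvgD; [exact: cvg_fst|exact: cvg_snd].
Qed.

(** Continuity is only asked of the coordinates, because configurations of
    several points will be given by their coordinates. *)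
Lemma edistance_continuous2 (T : topologicalType) (f g : T -> 'rV[R]_d) :
  (forall j, continuous (fun s => f s 0 j)) ->
  (forall j, continuous (fun s => g s 0 j)) ->
  continuous (fun s => edistance (f s) (g s)).
Proof.
move=> cf cg s; rewrite /continuous_at /edistance.
apply: (@cvg_comp _ _ _ (fun s => \sum_(j < d) (f s 0 j - g s 0 j) ^+ 2)
          (@Num.sqrt R)); last exact: sqrt_continuous.
apply: sum_continuous => j {}s; rewrite /continuous_at.
under eq_fun do rewrite expr2.
by rewrite expr2; apply: cvgM; apply: cvgB; (exact: cf || exact: cg).
Qed.

Lemma edistance_continuous y : continuous (fun x => edistance y x).
Proof.
apply: (@edistance_continuous2 _ (fun=> y) id) => j.
- exact: cst_continuous.
- exact: (@coord_continuous R 1 d 0 j).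
Qed.

End Euclid.

(** * Segments *)

Section Segments.
Variables (R : realType) (d : nat).
Implicit Types (x y z : 'rV[R]_d) (s t : R).

Definition line x y t : 'rV[R]_d := (1 - t) *: x + t *: y.

Lemma line0 x y : line x y 0 = x.
Proof. by rewrite /line subr0 scale1r scale0r addr0. Qed.

Lemma lineE x y t : line x y t = x + t *: (y - x).
Proof. by rewrite /line scalerBl scale1r scalerBr addrA addrAC. Qed.

Lemma lineC x y t : line x y t = line y x (1 - t).
Proof. by rewrite /line opprB addrC subrKC. Qed.

Lemma line_sub x y s t : line x y s - line x y t = (s - t) *: (y - x).
Proof. by rewrite !lineE opprD addrACA subrr add0r scalerBl. Qed.

Lemma line_dist x y s t :
  edistance (line x y s) (line x y t) = `|s - t| * edistance x y.
Proof. by rewrite edistanceE line_sub enormZ -edistanceE edistanceC. Qed.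

Lemma line_continuous x y : continuous (line x y).
Proof.
move=> t; rewrite /line; apply: cvgD; apply: cvgZr_tmp; last exact: cvg_id.
by apply: cvgB; [exact: cvg_cst|exact: cvg_id].
Qed.

Lemma segmentE x y : segment x y = line x y @` `[0, 1].
Proof.
by rewrite /segment; apply/seteqP; split => z [t + <-] => [t01|]; exists t => //=;
  rewrite ?in_itv//= in t01 *.
Qed.

Lemma segment_line x y t : 0 <= t <= 1 -> segment x y (line x y t).
Proof. by move=> t01; exists t. Qed.

Lemma segmentC x y : segment x y = segment y x.
Proof.
by apply/seteqP; split => _ [t /= t01 <-]; rewrite -/(line _ _ t) lineC;
  apply: segment_line; lra.
Qed.

Lemma segmentl x y : segment x y x.
Proof. by rewrite -{2}(line0 x y); apply: segment_line; rewrite lexx ler01. Qed.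

Lemma segmentr x y : segment x y y.
Proof. by rewrite segmentC; exact: segmentl. Qed.

Lemma connected_seg x y : connected (segment x y).
Proof.
rewrite segmentE; apply: connected_continuous_connected.
  exact: segment_connected.
exact/continuous_subspaceT/line_continuous.
Qed.

Lemma compact_seg x y : compact (segment x y).
Proof.
rewrite segmentE; apply: continuous_compact; last exact: segment_compact.
exact/continuous_subspaceT/line_continuous.
Qed.
End Segments.

(** * Length as an upper bound for the measure *)

Section Upper.
Variables (R : realType) (d : nat).
Implicit Types (x y z : 'rV[R]_d) (U E : set 'rV[R]_d).

Lemma ediameter_ge0 U : (0 <= ediameter U)%E.
Proof. by rewrite /ediameter le_max lexx. Qed.

Lemma le_ediameter U (c : R) : 0 <= c ->
  (forall x y, U x -> U y -> edistance x y <= c) -> (ediameter U <= c%:E)%E.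
Proof.
move=> c0 h; rewrite /ediameter ge_max lee_fin c0/=.
by apply: ge_ereal_sup => _ [[x y] [/= Ux Uy] <-]; rewrite lee_fin h.
Qed.

Lemma edistance_le_ediameter U x y : U x -> U y ->
  ((edistance x y)%:E <= ediameter U)%E.
Proof.
move=> Ux Uy; rewrite /ediameter le_max; apply/orP; right.
by apply: ereal_sup_ubound; exists (x, y).
Qed.

Lemma ediameter_set0 : ediameter (@set0 'rV[R]_d) = 0%E.
Proof. by apply/eqP; rewrite eq_le ediameter_ge0 le_ediameter. Qed.

Lemma hausdorff1_content_le_sum (I : finType) (U : I -> set 'rV[R]_d)
    (delta : R) E :
  0 <= delta -> E `<=` \bigcup_i U i ->
  (forall i, ediameter (U i) <= delta%:E)%E ->
  (hausdorff1_content delta E <= \sum_i ediameter (U i))%E.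
Proof.
move=> d0 EU hU; pose s := [seq U i | i <- enum I].
apply: ge_ereal_inf; exists (\sum_(0 <= k <oo) ediameter (nth set0 s k))%E.
  exists (nth set0 s) => //; split.
    move=> x /EU[i _ Ux]; exists (index i (enum I)) => //.
    by rewrite (nth_map i) ?nth_index ?index_mem ?mem_enum.
  move=> k; have [ks|ks] := ltnP k (size s); last first.
    by rewrite nth_default// ediameter_set0.
  by have /mapP[i _ ->] := mem_nth set0 ks.
rewrite (nneseries_split 0 (size s)); last by move=> k _; exact: ediameter_ge0.
rewrite eseries0 ?adde0 => [|k sk _]; last first.
  by rewrite nth_default// ediameter_set0.
rewrite add0n (_ : (\sum_(0 <= k < size s) _)%E = (\sum_(V <- s) ediameter V)%E).
  by rewrite big_map big_enum.
by rewrite (big_nth set0).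
Qed.

Lemma hausdorff1_segments_le (I : finType) (x y : I -> 'rV[R]_d) E :
  E `<=` \bigcup_i segment (x i) (y i) ->
  (hausdorff1 E <= (\sum_i edistance (x i) (y i))%:E)%E.
Proof.
move=> EU; apply: ge_ereal_sup => _ [delta /= d0 <-].
set L := \sum_i _; have L0 : 0 <= L by apply: sumr_ge0 => i _; exact: edistance_ge0.
(* [N] pieces per segment are short enough, whatever the segment *)
pose N := (Num.Def.archi_bound (L / delta)).+1.
have N0 : 0 < N%:R :> R by rewrite ltr0n.
have LN : L / N%:R <= delta.
  rewrite ler_pdivrMr// mulrC -ler_pdivrMr// ltW//.
  apply: (lt_le_trans (archi_boundP _)); first by rewrite divr_ge0// ltW.
  by rewrite ler_nat leqnSn.
have xyN i : edistance (x i) (y i) / N%:R <= delta.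
  apply: le_trans LN; rewrite ler_pM2r ?invr_gt0// /L (bigD1 i)//=.
  by rewrite lerDl sumr_ge0// => j _; exact: edistance_ge0.
pose U (p : I * 'I_N) := line (x p.1) (y p.1) @` `[p.2%:R / N%:R, p.2.+1%:R / N%:R].
have dU p : (ediameter (U p) <= (edistance (x p.1) (y p.1) / N%:R)%:E)%E.
  apply: le_ediameter; first by rewrite divr_ge0 ?edistance_ge0.
  move=> _ _ [s /= + <-] [t /= + <-]; rewrite !in_itv/= => hs ht.
  rewrite line_dist mulrC ler_wpM2l ?edistance_ge0//.
  move: hs ht; rewrite -natr1 mulrDl mul1r ler_norml; lra.
apply: le_trans (hausdorff1_content_le_sum (U := U) (ltW d0) _ _) _.
- move=> z /EU[i _ [t /= /andP[t0 t1] <-]].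
  have [t1'|tn1] := eqVneq t 1.
    exists (i, ord_max) => //; exists t; last by [].
    by rewrite t1' /= in_itv/= ler_pdivrMr// mul1r ler_nat leqnSn divff ?lexx// ?gt_eqF.
  have tN0 : 0 <= t * N%:R by rewrite mulr_ge0// ltW.
  have /andP[h1 h2] := truncn_itv tN0.
  have kN : (Num.trunc (t * N%:R) < N)%N.
    rewrite -(ltr_nat R); apply: le_lt_trans h1 _.
    by rewrite gtr_pMl// lt_neqAle tn1.
  exists (i, Ordinal kN) => //; exists t; last by [].
  by rewrite /= in_itv/= ler_pdivrMr// h1 ler_pdivlMr// ltW.
- by move=> p; apply: le_trans (dU p) _; rewrite lee_fin.
apply: le_trans (lee_sum _ (fun p _ => dU p)) _.
rewrite sumEFin lee_fin -(pair_big xpredT xpredT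
   (fun i (_ : 'I_N) => edistance (x i) (y i) / N%:R))/=.
apply: ler_sum => i _; rewrite sumr_const card_ord -[leLHS]mulr_natr.
by rewrite divfK ?lexx ?gt_eqF.
Qed.

End Upper.

(** * Length as a lower bound for the measure *)

Section Lower.
Variables (R : realType) (d : nat).
Implicit Types (x y z : 'rV[R]_d) (E : set 'rV[R]_d).

(** Each [W k] lies in the interval of length [c k] that starts at its infimum,
    so this is the subadditivity of Lebesgue measure. *)
Lemma interval_cover_le (W : (set R)^nat) (c : nat -> R) (a b : R) :
  (forall k, 0 <= c k) ->
  `[a, b] `<=` \bigcup_k W k ->
  (forall k s t, W k s -> W k t -> s - t <= c k) ->
  ((b - a)%:E <= \sum_(0 <= k <oo) (c k)%:E)%E.
Proof.
move=> c0 abW Wc.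
have mI (i : interval R) : measurable [set` i] by exact: measurable_itv.
pose J k := `[inf (W k), inf (W k) + c k]%classic.
have WJ k : W k `<=` J k.
  move=> s Ws; rewrite /J /mkset in_itv/=; apply/andP; split.
    by apply: ge_inf => //; exists (s - c k) => t Wt; rewrite lerBlDr -lerBlDl Wc.
  rewrite -lerBlDr; apply: lb_le_inf; first by exists s.
  by move=> t Wt; rewrite lerBlDr -lerBlDl Wc.
have muJ k : lebesgue_measure (J k) = (c k)%:E.
  rewrite lebesgue_measure_itv/= lte_fin ltrDl; case: ltP => [_|ck0].
    by rewrite -EFinD addrAC subrr add0r.
  by congr EFin; apply/eqP; rewrite eq_le c0.
have muab : ((b - a)%:E <= lebesgue_measure `[a, b]%classic)%E.
  rewrite lebesgue_measure_itv/= lte_fin; case: ltP => //.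
  by rewrite lee_fin subr_le0.
apply: le_trans muab _; rewrite -(eq_eseriesr (fun k _ => muJ k)).
apply: (@measure_sigma_subadditive _ _ _ (@lebesgue_measure R)
  `[a, b]%classic J (fun k => mI _) (mI _)).
exact: subset_trans abW (subset_bigcup (fun k _ => WJ k)).
Qed.

(** Arc length on the line turns the cover of a segment into a cover of an
    interval by sets that are no larger. *)
Lemma line_cover_le (W : (set 'rV[R]_d)^nat) x y (a b delta : R) :
  line x y @` `[a, b] `<=` \bigcup_k W k ->
  (forall k, ediameter (W k) <= delta%:E)%E ->
  (((b - a) * edistance x y)%:E <= \sum_(0 <= k <oo) ediameter (W k))%E.
Proof.
move=> abW Wd; set l := edistance x y.
have fW k : (ediameter (W k) = (fine (ediameter (W k)))%:E)%E.
  by rewrite fineK// ge0_fin_numE ?ediameter_ge0// (le_lt_trans (Wd k))// ltry.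
have [l0|l0] := eqVneq l 0.
  by rewrite l0 mulr0 nneseries_ge0// => k _ _; exact: ediameter_ge0.
have lgt0 : 0 < l by rewrite lt0r l0 edistance_ge0.
rewrite (eq_eseriesr (fun k _ => fW k)) mulrBl.
apply: (@interval_cover_le (fun k => [set s | W k (line x y (s / l))])).
- by move=> k; rewrite fine_ge0// ediameter_ge0.
- move=> s /=; rewrite in_itv/= => /andP[sa sb].
  have [|k _ Wk] := abW (line x y (s / l)); last by exists k.
  by exists (s / l) => //; rewrite /= in_itv/= ler_pdivlMr// sa ler_pdivrMr.
move=> k s t /= Ws Wt; apply: le_trans (ler_norm _) _.
rewrite -lee_fin -fW; apply: le_trans (edistance_le_ediameter Ws Wt).
rewrite line_dist -/l -mulrBl normrM [`|l^-1|]gtr0_norm ?invr_gt0//.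
by rewrite divfK.
Qed.

Lemma finite_common_radius (I : finType) (P : I -> R -> Prop) :
  (forall i, exists2 e : R, 0 < e & forall e' : R, 0 < e' <= e -> P i e') ->
  exists2 e : R, 0 < e & forall i, P i e.
Proof.
move=> h; have {h} /choice[f fP] : forall i, exists e : R,
    0 < e /\ forall e' : R, 0 < e' <= e -> P i e'.
  by move=> i; have [e ? ?] := h i; exists e.
exists (\big[Num.min/1]_i f i) => [|i].
  by apply: lt_bigmin => // i _; case: (fP i).
have [fi0 fiP] := fP i; apply: fiP; apply/andP; split; last exact: bigmin_le.
by apply: lt_bigmin => // j _; case: (fP j).
Qed.

(** Without their ends, segments that only meet at endpoints become disjoint
    compact sets. *)
Definition core (theta : R) x y : set 'rV[R]_d :=
  line x y @` `[theta, 1 - theta].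

(** The distance between two points, one on either core, attains its minimum,
    which is positive because the cores are disjoint. *)
Lemma cores_separated (I : finType) (x y : I -> 'rV[R]_d) (theta : R) :
  0 < theta <= 2^-1 ->
  (forall i j (s t : R), i != j -> 0 < s < 1 -> 0 < t < 1 ->
     line (x i) (y i) s != line (x j) (y j) t) ->
  exists2 delta : R, 0 < delta & forall i j, i != j -> forall u v,
    core theta (x i) (y i) u -> core theta (x j) (y j) v ->
    delta < edistance u v.
Proof.
move=> /andP[th0 th1] disj.
suff [e e0 h] : exists2 e : R, 0 < e & forall p : I * I, p.1 != p.2 ->
    forall u v, core theta (x p.1) (y p.1) u -> core theta (x p.2) (y p.2) v ->
    e < edistance u v.
  by exists e => // i j ij; exact: (h (i, j)).
apply: finite_common_radius => -[i j]/=.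
have [->|ij] := eqVneq i j; first by exists 1.
pose f (z : R * R) := edistance (line (x i) (y i) z.1) (line (x j) (y j) z.2).
have cf : continuous f.
  apply: edistance_continuous2 => k z.
    apply: (@continuous_comp _ _ _ fst (fun s => line (x i) (y i) s 0 k)).
      exact: cvg_fst.
    apply: (@continuous_comp _ _ _ (line (x i) (y i))
      (fun M : 'rV[R]_d => M 0 k)); first exact: line_continuous.
    exact: (@coord_continuous R 1 d 0 k).
  apply: (@continuous_comp _ _ _ snd (fun s => line (x j) (y j) s 0 k)).
    exact: cvg_snd.
  apply: (@continuous_comp _ _ _ (line (x j) (y j))
    (fun M : 'rV[R]_d => M 0 k)); first exact: line_continuous.
  exact: (@coord_continuous R 1 d 0 k).
pose K := `[theta, 1 - theta]%classic `*` `[theta, 1 - theta]%classic.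
have K0 : K !=set0.
  by exists (theta, theta); split; rewrite /= in_itv/= lexx; lra.
have cK : compact K by apply: compact_setX; exact: segment_compact.
have [z] := compact_EVT_min K0 cK (continuous_subspaceT cf).
rewrite inE => -[]; rewrite /= !in_itv/= => zi zj fz.
have fz0 : 0 < f z.
  rewrite /f lt0r edistance_ge0 andbT edistance_eq0 disj//; lra.
exists (f z / 2) => [|e /andP[e0 ez] _ _ _ [s hs <-] [t ht <-]].
  by rewrite divr_gt0.
apply: (@lt_le_trans _ _ (f z)); first by lra.
by apply: (fz (s, t)); rewrite inE.
Qed.

Lemma hausdorff1_cores_ge (I : finType) (x y : I -> 'rV[R]_d) (theta delta : R)
    E :
  0 < delta ->
  (forall i, core theta (x i) (y i) `<=` E) ->
  (forall i j, i != j -> forall u v,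
    core theta (x i) (y i) u -> core theta (x j) (y j) v ->
    delta < edistance u v) ->
  (((1 - theta - theta) * \sum_i edistance (x i) (y i))%:E <= hausdorff1 E)%E.
Proof.
move=> d0 coreE sep.
apply: (@le_trans _ _ (hausdorff1_content delta E)); last first.
  by apply: ereal_sup_ubound; exists delta.
apply: le_ereal_inf_tmp => _ [U [EU Ud] <-].
pose meets i k := `[< U k `&` core theta (x i) (y i) !=set0 >].
pose f i k := if meets i k then ediameter (U k) else 0%E.
have f0 i k : (0 <= f i k)%E by rewrite /f; case: ifP => // _; exact: ediameter_ge0.
(* a set of small diameter meets at most one core *)
have sumf k : (\sum_i f i k <= ediameter (U k))%E.
  have [[i mi]|nm] := pselect (exists i, meets i k); last first.
    rewrite big1 ?ediameter_ge0// => i _; rewrite /f ifF//.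
    by apply/negP => mi; apply: nm; exists i.
  rewrite (bigD1 i)//= big1 ?adde0 => [|j ji]; first by rewrite /f mi.
  rewrite /f ifF//; apply/negP => /asboolP[v [Uv cv]].
  move/asboolP: mi => [u [Uu cu]].
  have := edistance_le_ediameter Uv Uu; apply/negP; rewrite -ltNge.
  by apply: le_lt_trans (Ud k) _; rewrite lte_fin (sep j i).
apply: (@le_trans _ _ (\sum_(0 <= k <oo) \sum_i f i k)%E); last first.
  by apply: lee_nneseries => // k _ _; apply: sume_ge0.
rewrite nneseries_sum// mulr_sumr -sumEFin; apply: lee_sum => i _.
pose W k := U k `&` core theta (x i) (y i).
have Wf k : (ediameter (W k) <= f i k)%E.
  rewrite /f; case: ifPn => [_|/asboolPn nm].
    rewrite {1}/ediameter ge_max ediameter_ge0/=.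
    by apply: ge_ereal_sup => _ [[u v] [[/= Uu _] [Uv _]] <-];
      exact: edistance_le_ediameter.
  by apply: le_ediameter => // u v Wu; case: nm; exists u.
have fd k : (f i k <= delta%:E)%E.
  by rewrite /f; case: ifP => // _; rewrite lee_fin ltW.
apply: le_trans (lee_nneseries (fun k _ _ => ediameter_ge0 _)
  (fun k (_ : true) => Wf k)).
apply: (@line_cover_le _ _ _ _ _ delta); last first.
  by move=> k; exact: le_trans (Wf k) (fd k).
move=> u cu; have [k _ Uu] := EU _ (coreE i _ cu).
by exists k.
Qed.

(** Segments that do not cross have total length at most the measure of their
    union: away from their endpoints they are at positive distance from each
    other, so that a fine cover splits into covers of each of them. *)
Lemma hausdorff1_segments_ge (I : finType) (x y : I -> 'rV[R]_d) E :
  (forall i, segment (x i) (y i) `<=` E) ->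
  (forall i j (s t : R), i != j -> 0 < s < 1 -> 0 < t < 1 ->
     line (x i) (y i) s != line (x j) (y j) t) ->
  ((\sum_i edistance (x i) (y i))%:E <= hausdorff1 E)%E.
Proof.
move=> segE disj; apply/lee_addgt0Pr => e e0; set L := \sum_i _.
have L0 : 0 <= L by apply: sumr_ge0 => i _; exact: edistance_ge0.
have Le : 0 < 2 * (L + e) by lra.
pose theta := e / (2 * (L + e)).
have th0 : 0 < theta by rewrite divr_gt0.
have th1 : theta <= 2^-1 by rewrite ler_pdivrMr//; lra.
have thL : theta * L <= e / 2 by rewrite mulrAC ler_pdivrMr//; nra.
have [|delta d0 sep] := @cores_separated _ x y theta _ disj; first by rewrite th0.
have cE i : core theta (x i) (y i) `<=` E.
  move=> _ [s /= + <-]; rewrite in_itv/= => hs.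
  by apply: segE; apply: segment_line; lra.
have := hausdorff1_cores_ge d0 cE sep; rewrite -/L => h.
apply: (@le_trans _ _ (((1 - theta - theta) * L)%:E + e%:E)%E).
  by rewrite -EFinD lee_fin; lra.
exact: leeD2r.
Qed.

End Lower.

(** * Nets of polylines in connected sets *)

Section Polyline.
Variables (R : realType) (d : nat).
Implicit Types (x y q b : 'rV[R]_d) (s t : seq 'rV[R]_d).

Fixpoint plen x s : R :=
  if s is y :: s' then edistance x y + plen y s' else 0.

Lemma plen_cat x s t : plen x (s ++ t) = plen x s + plen (last x s) t.
Proof. by elim: s x => [|y s IHs] x /=; rewrite ?add0r// IHs addrA. Qed.

Lemma plen_rcons x s y : plen x (rcons s y) = plen x s + edistance (last x s) y.
Proof. by rewrite -cats1 plen_cat /= addr0. Qed.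

Lemma edistance_last_le x s : edistance x (last x s) <= plen x s.
Proof.
elim: s x => [|y s IHs] x /=; first by rewrite edistancexx.
by apply: le_trans (edistance_triangle y _ _) _; rewrite lerD2l.
Qed.

(** The graph with edge list [es] and points as vertices is connected and, unless
    it has no edge, contains [b0]: a property that passes along edges and holds at
    [b0] holds everywhere. In this form, without paths, connectedness is easily
    seen to survive the subdivision of an edge and any map of the points. *)
Definition linked b0 (es : seq ('rV[R]_d * 'rV[R]_d)) : Prop :=
  forall P : 'rV[R]_d -> Prop, (forall p, p \in es -> (P p.1 <-> P p.2)) ->
    P b0 -> forall p, p \in es -> P p.1.

End Polyline.

Section Nets.
Variables (R : realType) (d : nat) (T : set 'rV[R]_d) (V : nat -> set 'rV[R]_d).
Variables (w : nat -> R) (delta : R).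
Hypotheses (connT : connected T) (openV : forall k, open (V k)).
Hypotheses (coverT : T `<=` \bigcup_k V k).
Hypotheses (w_ge0 : forall k, 0 <= w k).
Hypotheses (diamV : forall k x y, V k x -> V k y -> edistance x y <= w k).
Hypothesis (w_le : forall k, w k <= delta).
Implicit Types (x y q b : 'rV[R]_d) (k l : nat) (K : seq nat).

Let adj : rel nat := fun k l => `[< V k `&` V l !=set0 >].

(** The cover elements reachable from [V k0] in the nerve and the remaining ones
    have disjoint open unions, and a connected set lies in one of these. *)
Lemma nerve_connected k0 x0 b : T x0 -> V k0 x0 -> T b ->
  exists k p, [/\ V k b, path adj k p & last k p = k0].
Proof.
move=> Tx0 V0 Tb; pose good k := exists2 p, path adj k p & last k p = k0.
have goodV k l : good k -> V k `&` V l !=set0 -> good l.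
  move=> [p ep lp] [x [Vk Vl]]; exists (k :: p) => //=; rewrite ep andbT.
  by apply/asboolP; exists x.
suff TE : T `&` \bigcup_(k in good) V k = T.
  move: Tb; rewrite -TE => -[_ [k [p ep lp] Vk]].
  by exists k, p.
apply: connT.
- by exists x0; split=> //; exists k0 => //; exists [::].
- by exists (\bigcup_(k in good) V k) => //; exact: bigcup_open.
exists (~` \bigcup_(k in [set k | ~ good k]) V k).
  exact/open_closedC/bigcup_open.
apply/seteqP; split => x [Tx].
  move=> [k gk Vk]; split=> // -[l ngl Vl]; apply: ngl.
  by apply: goodV gk _; exists x.
move=> nx; split=> //; have [k _ Vk] := coverT Tx.
by exists k => //; apply: contrapT => ngk; apply: nx; exists k.
Qed.

Lemma path_first_hit K k p : path adj k p -> last k p \in K ->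
  exists p', [/\ path adj k p', last k p' \in K,
    subseq (belast k p') (belast k p) &
    forall j, j \in belast k p' -> j \notin K].
Proof.
elim: p k => [|l p IHp] k /=; first by move=> _ kK; exists [::].
move=> /andP[kl lp] lK; have [kK|kK] := boolP (k \in K).
  by exists [::]; split => //; rewrite sub0seq.
have [p' [ep lp' sp np]] := IHp _ lp lK.
exists (l :: p'); split => //=; [by rewrite kl|by rewrite eqxx|].
by move=> j; rewrite inE => /predU1P[->|/np].
Qed.

(** Passing from one element of the chain to the next through a common point
    costs at most the diameter of the element that is left. *)
Lemma path_polyline k p x : path adj k p -> V k x ->
  exists s, [/\ V (last k p) (last x s), plen x s <= \sum_(j <- belast k p) w j &
    forall j, j \in belast k p -> exists2 q, q \in x :: s & V j q].
Proof.
elim: p k x => [|l p IHp] k x /=; first by move=> _ Vx; exists [::]; rewrite big_nil.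
move=> /andP[/asboolP[y [Vky Vly]] lp] Vkx.
have [s [Vs ls ts]] := IHp _ _ lp Vly.
exists (y :: s); split => //=.
  by rewrite big_cons lerD// diamV.
move=> j; rewrite inE => /predU1P[->|/ts[q qs Vq]].
  by exists x => //; rewrite mem_head.
by exists q => //; rewrite inE qs orbT.
Qed.

(** [ps] is a family of polylines that joins [b0] to the points [bs], and whose
    length is paid by the cover elements [K] that it visits, up to [delta] for
    each point of [bs]. *)
Record net b0 (bs : seq 'rV[R]_d) (ps : seq ('rV[R]_d * seq 'rV[R]_d)) K :
    Prop := Net {
  net_size : (size ps <= 2 * size bs)%N;
  net_length : \sum_(p <- ps) plen p.1 p.2 <=
               \sum_(k <- K) w k + (size bs)%:R * delta;
  net_uniq : uniq K;
  net_visit : forall k, k \in K ->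
    exists2 p, p \in ps & exists2 q, q \in p.1 :: p.2 & V k q;
  net_root : exists2 k, k \in K & V k b0;
  net_heads : forall b, b \in bs -> exists2 p, p \in ps & p.1 = b;
  net_linked : linked b0 [seq (p.1, last p.1 p.2) | p <- ps] }.

(** A path in the nerve of the cover from [b] to the first element already in
    [K] gives a polyline whose length is paid by new elements of [K]; reaching
    the net inside that last element costs [delta]. The polyline of the net
    that contains the attachment point is cut there. *)
Lemma net_add b0 bs ps K b : T b0 -> T b -> net b0 bs ps K ->
  exists ps' K', net b0 (b :: bs) ps' K'.
Proof.
move=> Tb0 Tb [sz len uK visit [k0 k0K Vk0] heads lnk].
have [k [p0 [Vkb ep0 lp0]]] := nerve_connected Tb0 Vk0 Tb.
case/shortenP: ep0 lp0 => p1 ep1 up1 _ lp1.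
have [|p [ep lpK sp pK]] := @path_first_hit K k p1 ep1; first by rewrite lp1.
have up : uniq (belast k p).
  apply: subseq_uniq sp _; move: up1; rewrite lastI rcons_uniq => /andP[]//.
have [s [Vs ls visits]] := path_polyline ep Vkb.
have [[h t] htps [q /= qt Vq]] := visit _ lpK.
case/path.splitPr: htps sz len visit heads lnk => A B.
case/splitPl: qt => t1 t2 lt1 sz len visit heads lnk.
exists (A ++ [:: (h, t1), (q, t2), (b, rcons s q) & B]), (belast k p ++ K).
split.
- by move: sz; rewrite !size_cat /= mulnS; lia.
- move: len; rewrite !big_cat !big_cons/= plen_cat plen_rcons lt1 -natr1 mulrDl.
  have := le_trans (diamV Vs Vq) (w_le _); lra.
- rewrite cat_uniq up uK andbT/=; apply/hasPn => j jK.
  by apply/negP => /pK; rewrite jK.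
- move=> j; rewrite mem_cat => /orP[/visits[z zs Vz]|/visit[[h' t'] h'P [z /= zt Vz]]].
    exists (b, rcons s q); first by rewrite mem_cat !inE eqxx !orbT.
    by exists z => //=; rewrite -rcons_cons mem_rcons inE zs orbT.
  move: h'P; rewrite mem_cat inE => /or3P[h'A|/eqP[h'E t'E]|h'B].
  + by exists (h', t'); [rewrite mem_cat h'A|exists z].
  + move: zt; rewrite h'E t'E -cat_cons mem_cat => /orP[z1|z2].
      by exists (h, t1); [rewrite mem_cat !inE eqxx !orbT|exists z].
    exists (q, t2); first by rewrite mem_cat !inE eqxx !orbT.
    by exists z => //=; rewrite inE z2 orbT.
  + by exists (h', t'); [rewrite mem_cat !inE h'B !orbT|exists z].
- by exists k0 => //; rewrite mem_cat k0K orbT.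
- move=> z; rewrite inE => /predU1P[->|/heads[[h' t'] h'P /= <-]].
    by exists (b, rcons s q) => //; rewrite mem_cat !inE eqxx !orbT.
  move: h'P; rewrite mem_cat inE => /or3P[h'A|/eqP[h'E t'E]|h'B].
  + by exists (h', t') => //; rewrite mem_cat h'A.
  + by exists (h, t1) => //; rewrite mem_cat !inE eqxx !orbT.
  + by exists (h', t') => //; rewrite mem_cat !inE h'B !orbT.
move=> P Pes Pb0.
have PA e : e \in [seq (p.1, last p.1 p.2) | p <- A] -> P e.1 <-> P e.2.
  by move=> eA; apply: Pes; rewrite map_cat mem_cat eA.
have PB e : e \in [seq (p.1, last p.1 p.2) | p <- B] -> P e.1 <-> P e.2.
  by move=> eB; apply: Pes; rewrite map_cat mem_cat /= !inE eB !orbT.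
have Phq : P h <-> P q.
  by have := Pes (h, q); apply; rewrite map_cat mem_cat /= !inE lt1 eqxx !orbT.
have Pqt : P q <-> P (last q t2).
  by have := Pes (q, last q t2); apply; rewrite map_cat mem_cat /= !inE eqxx !orbT.
have Pbq : P b <-> P q.
  by have := Pes (b, q); apply;
    rewrite map_cat mem_cat /= !inE last_rcons eqxx !orbT.
have old e : e \in [seq (p.1, last p.1 p.2) | p <- A ++ (h, t1 ++ t2) :: B] -> P e.1.
  apply: lnk Pb0 e => e; rewrite map_cat mem_cat inE => /or3P[/PA//|/eqP->|/PB//].
  by rewrite /= last_cat lt1 Phq.
have Ph : P h.
  by apply: (old (h, last h (t1 ++ t2))); rewrite map_cat mem_cat /= !inE eqxx !orbT.
move=> e; rewrite map_cat mem_cat !inE.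
case/or4P => [eA|/eqP->|/eqP->|/orP[/eqP->|eB]]//=.
- by apply: old; rewrite map_cat mem_cat eA.
- exact/Phq.
- exact/Pbq/Phq.
- by apply: old; rewrite map_cat mem_cat /= !inE eB !orbT.
Qed.

Lemma net_exists b0 bs : T b0 -> (forall b, b \in bs -> T b) ->
  exists ps K, net b0 (b0 :: bs) ps K.
Proof.
move=> Tb0 Tbs; suff [ps [K [sz len uK visit root heads lnk]]] :
    exists ps K, net b0 (rcons bs b0) ps K.
  exists ps, K; split => //; [by rewrite size_rcons in sz| |].
    by rewrite size_rcons in len.
  by move=> b bb; apply: heads; rewrite mem_rcons.
elim: bs Tbs => [|b bs IHbs] Tbs /=.
  have [k _ Vk] := coverT Tb0.
  exists [:: (b0, [::])], [:: k]; split => //=.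
  - rewrite !big_seq1/= mul1r addr_ge0//; exact: le_trans (w_le k).
  - move=> l; rewrite inE => /eqP->; exists (b0, [::]); first by rewrite mem_head.
    by exists b0; rewrite ?mem_head.
  - by exists k; rewrite ?mem_head.
  - by move=> b; rewrite inE => /eqP->; exists (b0, [::]); rewrite ?mem_head.
  - by move=> P _ Pb0 e; rewrite inE => /eqP->.
have [|ps [K hK]] := IHbs; first by move=> c cbs; apply: Tbs; rewrite inE cbs orbT.
by apply: net_add hK => //; apply: Tbs; rewrite mem_head.
Qed.

End Nets.

(** * Spanning families of segments *)

Section Spanning.
Variables (R : realType) (d n : nat) (B : 'I_n -> 'rV[R]_d) (i0 : 'I_n).
Implicit Types (x y : 'rV[R]_d) (es : seq ('rV[R]_d * 'rV[R]_d)).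

Definition spanning es : Prop :=
  (forall i, exists2 p, p \in es & p.1 = B i) /\ linked (B i0) es.

Definition cost es : R := \sum_(p <- es) edistance p.1 p.2.

Lemma hausdorff1_ge0 (T : set 'rV[R]_d) : (0 <= hausdorff1 T)%E.
Proof.
apply: (@le_trans _ _ (hausdorff1_content 1 T)); last first.
  by apply: ereal_sup_ubound; exists 1 => /=.
apply: le_ereal_inf_tmp => _ [U _ <-].
by apply: nneseries_ge0 => k _ _; exact: ediameter_ge0.
Qed.

Lemma sum_uniq_le_series (u : nat -> R) (K : seq nat) :
  (forall k, 0 <= u k) -> uniq K ->
  exists m, \sum_(k <- K) u k <= \sum_(0 <= k < m) u k.
Proof.
move=> u0 uK; exists (\max_(k <- K) k).+1.
have Km k : k \in K -> (k < (\max_(k <- K) k).+1)%N.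
  by move=> kK; rewrite ltnS (big_rem k)//= leq_maxl.
have pK : perm_eq K [seq k <- index_iota 0 (\max_(k <- K) k).+1 | k \in K].
  apply: uniq_perm => //; first by rewrite filter_uniq ?iota_uniq.
  move=> k; rewrite mem_filter mem_index_iota/=.
  by case: (boolP (k \in K)) => //= /Km ->.
rewrite (perm_big _ pK) big_filter big_mkcond/=; apply: ler_sum => k _.
by case: ifPn => // _; exact: u0.
Qed.

Lemma sum_geometric_half_le m : \sum_(0 <= k < m) 2^-1 ^+ k.+1 <= 1 :> R.
Proof.
suff -> : \sum_(0 <= k < m) 2^-1 ^+ k.+1 = 1 - 2^-1 ^+ m :> R.
  by rewrite lerBlDr lerDl exprn_ge0.
elim: m => [|m IHm]; first by rewrite big_geq// expr0 subrr.
by rewrite big_nat_recr//= IHm exprS; lra.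
Qed.

(** A connected set containing the terminals is, up to [e], at least as long
    as a spanning family of boundedly many segments: thicken an almost optimal
    fine cover to an open one, and use its net. *)
Lemma spanning_le_hausdorff1 (T : set 'rV[R]_d) (c e : R) :
  connected T -> range B `<=` T -> (hausdorff1 T <= c%:E)%E -> 0 < e ->
  exists es, [/\ (size es <= 2 * n.+1)%N, cost es <= c + e & spanning es].
Proof.
move=> connT BT Tc e0; set N : R := n.+1%:R.
have N1 : 1 <= N by rewrite ler1n.
have Nn0 : N != 0 by rewrite pnatr_eq0.
pose delta1 := e / (4 * N); pose r0 := e / (8 * N).
have d1 : 0 < delta1 by rewrite divr_gt0//; lra.
have r00 : 0 < r0 by rewrite divr_gt0//; lra.
have Nd1 : N * delta1 = e / 4 by rewrite /delta1; field.
have Nr0 : N * r0 = e / 8 by rewrite /r0; field.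
have hT : (hausdorff1_content delta1 T < (c + e / 4)%:E)%E.
  apply: (@le_lt_trans _ _ c%:E); last by rewrite lte_fin; lra.
  by apply: le_trans Tc; apply: ereal_sup_ubound; exists delta1.
have [_ [U [TU Ud] <-] Uc] := ereal_inf_lt hT.
have fU k : (ediameter (U k) = (fine (ediameter (U k)))%:E)%E.
  by rewrite fineK// ge0_fin_numE ?ediameter_ge0// (le_lt_trans (Ud k))// ltry.
pose D k := fine (ediameter (U k)).
have D0 k : 0 <= D k by rewrite fine_ge0// ediameter_ge0.
have Dd k : D k <= delta1 by rewrite -lee_fin -fU.
pose rad k : R := r0 * 2^-1 ^+ k.+1.
have rad0 k : 0 < rad k by rewrite mulr_gt0// exprn_gt0.
have radr k : rad k <= r0.
  by rewrite ler_piMr ?(ltW r00)// exprn_ile1// invf_le1// ler1n.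
pose V k := \bigcup_(y in U k) [set x | edistance y x < rad k].
have openV k : open (V k).
  apply: bigcup_open => y _.
  apply: (@open_comp _ _ (fun x => edistance y x) [set r : R | r < rad k]).
    by move=> x _; exact: edistance_continuous.
  exact: open_lt.
have coverT : T `<=` \bigcup_k V k.
  by move=> x /TU[k _ Ux]; exists k => //; exists x => //=; rewrite edistancexx.
pose w k := D k + 2 * rad k.
have w0 k : 0 <= w k by rewrite addr_ge0// mulr_ge0// ltW.
have diamV k x y : V k x -> V k y -> edistance x y <= w k.
  move=> [x' Ux /= hx] [y' Uy /= hy].
  have : edistance x' y' <= D k by rewrite -lee_fin -fU edistance_le_ediameter.
  have := edistance_triangle x' x y; have := edistance_triangle y' x' y.
  by rewrite (edistanceC x x') /w; lra.
have wd k : w k <= 2 * delta1.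
  have h : 2 * r0 = delta1 by rewrite /r0 /delta1; field.
  by rewrite /w [leRHS]mulr_natl mulr2n lerD// -h ler_pM2l.
have [|ps [K [sz len uK _ _ heads lnk]]] :=
    net_exists connT openV coverT w0 diamV wd (bs := [seq B i | i <- enum 'I_n])
      (BT _ (imageT B i0)).
  by move=> b /mapP[i _ ->]; exact: (BT _ (imageT B i)).
exists [seq (p.1, last p.1 p.2) | p <- ps]; split.
- by move: sz; rewrite size_map /= size_map size_enum_ord.
- rewrite /cost big_map; apply: (@le_trans _ _ (\sum_(p <- ps) plen p.1 p.2)).
    by apply: ler_sum => p _; exact: edistance_last_le.
  apply: le_trans len _; rewrite /= size_map size_enum_ord -/N.
  have [m1 h1] := sum_uniq_le_series D0 uK.
  have [m2 h2] := sum_uniq_le_series (fun k => ltW (rad0 k)) uK.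
  have h3 : \sum_(0 <= k < m1) D k <= c + e / 4.
    rewrite -lee_fin -sumEFin; apply: le_trans (ltW Uc).
    under eq_bigr do rewrite -fU.
    apply: (nneseries_lim_ge (u_ := fun k => ediameter (U k)) (P := xpredT)).
    by move=> k _ _; exact: ediameter_ge0.
  have h4 : \sum_(0 <= k < m2) rad k <= r0.
    by rewrite -mulr_sumr ler_piMr ?(ltW r00)// sum_geometric_half_le.
  rewrite big_split/= -mulr_sumr mulrCA Nd1.
  have : r0 <= e / 8 by rewrite -Nr0 ler_peMl// ltW.
  by lra.
split=> [i|]; last by [].
have [|p pps pE] := heads (B i); first by rewrite inE map_f ?orbT// mem_enum.
by exists (p.1, last p.1 p.2) => //; apply/mapP; exists p.
Qed.
End Spanning.

(** * Existence of Steiner trees *)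

Section Existence.
Variables (R : realType) (d n : nat) (B : 'I_n -> 'rV[R]_d) (i0 : 'I_n).
Implicit Types (x y : 'rV[R]_d) (es : seq ('rV[R]_d * 'rV[R]_d)).

(** Padding by the trivial segment at the root puts all families of at most [m]
    segments in one finite-dimensional space. *)
Lemma spanning_pad es (m : nat) : (size es <= m)%N -> spanning B i0 es ->
  let es' := [seq nth (B i0, B i0) es j | j : 'I_m] in
  spanning B i0 es' /\ cost es' = cost es.
Proof.
move=> esm [heads lnk] es'.
have es'P p : p \in es' -> p \in es \/ p = (B i0, B i0).
  move=> /codomP[j ->]; have [je|ej] := ltnP j (size es).
    by left; exact: mem_nth.
  by right; rewrite nth_default.
have sub p : p \in es -> p \in es'.
  move=> pes; have jm : (index p es < m)%N.
    by apply: leq_trans esm; rewrite index_mem.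
  by apply/codomP; exists (Ordinal jm); rewrite /= nth_index.
split; last first.
  rewrite /cost big_map big_enum/= -(big_mkord xpredT
    (fun j => edistance (nth (B i0, B i0) es j).1 (nth (B i0, B i0) es j).2)).
  rewrite (@big_cat_nat _ _ _ (size es))//= [X in _ + X]big1_seq ?addr0.
    by rewrite [RHS](big_nth (B i0, B i0)).
  move=> j /=; rewrite mem_index_iota => /andP[ej _].
  by rewrite nth_default// edistancexx.
split=> [i|P Pes' PB p pes'].
  by have [p pes <-] := heads i; exists p => //; exact: sub.
have [pes|->//] := es'P _ pes'.
by apply: lnk PB _ pes => q qes; apply: Pes'; exact: sub.
Qed.

Lemma spanning_map (phi : 'rV[R]_d -> 'rV[R]_d) es :
  (forall i, phi (B i) = B i) -> spanning B i0 es ->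
  spanning B i0 [seq (phi p.1, phi p.2) | p <- es].
Proof.
move=> phiB [heads lnk]; split=> [i|P Pes PB _ /mapP[p pes ->]/=].
  have [p pes pi] := heads i; exists (phi p.1, phi p.2) => /=.
    by apply/mapP; exists p.
  by rewrite pi.
apply: (lnk (P \o phi)) => //=; last by rewrite phiB.
by move=> q qes; apply: (Pes (phi q.1, phi q.2)); apply/mapP; exists q.
Qed.

(** Clamping the coordinates is the nearest-point map of a box: it does not
    increase distances. *)
Definition clamp (M : R) x : 'rV[R]_d :=
  \row_j Num.max (- M) (Num.min M (x 0 j)).

Lemma clamp_edistance_le M x y :
  0 <= M -> edistance (clamp M x) (clamp M y) <= edistance x y.
Proof.
move=> M0; rewrite /edistance ler_sqrt; last first.
  by apply: sumr_ge0 => j _; exact: sqr_ge0.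
apply: ler_sum => j _; rewrite !mxE -[leLHS]real_normK ?num_real//.
rewrite -[leRHS]real_normK ?num_real//.
rewrite ler_sqr ?nnegrE//; set s := x 0 j; set t := y 0 j.
have h1 := ler_norm (s - t); have h2 := ler_norm (t - s).
rewrite distrC in h2; move: (`|s - t|) h1 h2 => r h1 h2.
rewrite /Num.max /Num.min; case: (ltP M s) => ?; case: (ltP M t) => ?;
  case: (ltP (- M) M) => ?; case: (ltP (- M) s) => ?; case: (ltP (- M) t) => ?;
  rewrite ler_norml; lra.
Qed.

Lemma clamp_id M x : (forall j, `|x 0 j| <= M) -> clamp M x = x.
Proof.
move=> xM; apply/rowP => j; rewrite mxE.
by have := xM j; rewrite ler_norml => /andP[h1 h2]; rewrite min_r// max_r.
Qed.

Section Configurations.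
Variable m : nat.
Implicit Types (c : 'rV[R]_#|{: 'I_m * bool * 'I_d}|) (v : 'I_m * bool).

(** A configuration is a single row vector with the coordinates of all
    endpoints, so that a product of intervals is compact. *)
Definition cpoint c v : 'rV[R]_d := \row_j c 0 (enum_rank (v, j)).

Definition csegments c : seq ('rV[R]_d * 'rV[R]_d) :=
  [seq (cpoint c (j, false), cpoint c (j, true)) | j : 'I_m].

Lemma csegments_surj (f : 'I_m -> 'rV[R]_d * 'rV[R]_d) :
  exists c, forall j, cpoint c (j, false) = (f j).1 /\
                      cpoint c (j, true) = (f j).2.
Proof.
exists (\row_k let: (j, b, l) := enum_val k in
          if b then (f j).2 0 l else (f j).1 0 l) => j.
by split; apply/rowP => l; rewrite !mxE enum_rankK.
Qed.

Lemma cpoint_continuous v j : continuous (fun c => cpoint c v 0 j).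
Proof.
rewrite (_ : (fun c => _) = (fun c => c 0 (enum_rank (v, j)))).
  exact: (@coord_continuous R 1 _ 0 (enum_rank (v, j))).
by apply/funext => c; rewrite mxE.
Qed.

Lemma cost_continuous : continuous (fun c => cost (csegments c)).
Proof.
rewrite (_ : (fun c => _) = (fun c => \sum_(j < m)
    edistance (cpoint c (j, false)) (cpoint c (j, true)))).
  apply: sum_continuous => j; apply: edistance_continuous2 => k;
  exact: cpoint_continuous.
by apply/funext => c; rewrite /cost big_map big_enum.
Qed.

(** There are finitely many ways for [m] segments to be spanning: a pattern
    records coincidences between endpoints, and an endpoint at each terminal. *)
Definition pattern :=
  ({set ('I_m * bool) * ('I_m * bool)} * {ffun 'I_n -> 'I_m})%type.

(** The coincidences make the segments a connected graph: a set [X] of endpoints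
    that respects segments and coincidences, and contains the root, is full. *)
Definition good_pattern (q : pattern) : Prop :=
  forall X : {set 'I_m * bool},
    (forall j, ((j, false) \in X) = ((j, true) \in X)) ->
    (forall p, p \in q.1 -> (p.1 \in X) = (p.2 \in X)) ->
    (q.2 i0, false) \in X -> forall v, v \in X.

Definition follows (q : pattern) : set 'rV[R]_#|{: 'I_m * bool * 'I_d}| :=
  \bigcap_(p in [set p | p \in q.1])
     [set c | edistance (cpoint c p.1) (cpoint c p.2) = 0] `&`
  \bigcap_(i in [set: 'I_n])
     [set c | edistance (B i) (cpoint c (q.2 i, false)) = 0].

Lemma closed_follows q : closed (follows q).
Proof.
apply: closedI; apply: closed_bigI => i _;
  apply: (@closed_comp _ _ _ [set 0 : R]); try exact: closed_eq.
  by move=> c _; apply: edistance_continuous2 => j; exact: cpoint_continuous.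
move=> c _; apply: edistance_continuous2 => j; last exact: cpoint_continuous.
exact: cst_continuous.
Qed.

Lemma spanning_csegments c :
  spanning B i0 (csegments c) <-> exists2 q, good_pattern q & follows q c.
Proof.
split=> [[heads lnk]|[[C t] /= good [/= hC ht]]].
  have /choice[t tP] : forall i, exists j, cpoint c (j, false) = B i.
    by move=> i; have [_ /codomP[j ->] /= <-] := heads i; exists j.
  exists (finset (fun p => cpoint c p.1 == cpoint c p.2), [ffun i => t i]).
    move=> X /= Xe XC Xt.
    have key u v : u \in X -> cpoint c u = cpoint c v -> v \in X.
      by move=> uX uv; rewrite -(XC (u, v))// inE uv.
    suff Xf j : (j, false) \in X by move=> [j []]; rewrite -?Xe Xf.
    have [|||v vX vj] := lnk (fun x => exists2 v, v \in X & cpoint c v = x) _ _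
      (cpoint c (j, false), cpoint c (j, true)).
    - move=> _ /codomP[l ->] /=; split=> -[v vX vl].
        by exists (l, true) => //; rewrite -Xe; exact: key vX vl.
      by exists (l, false) => //; rewrite Xe; exact: key vX vl.
    - by exists (t i0, false); rewrite ?tP//; move: Xt; rewrite ffunE.
    - exact: codom_f.
    - exact: key vX vj.
  split=> [p /= |i _ /=]; first by rewrite inE => /eqP->; rewrite edistancexx.
  by rewrite ffunE tP edistancexx.
have hC' p : p \in C -> cpoint c p.1 = cpoint c p.2.
  by move=> /hC/eqP; rewrite edistance_eq0 => /eqP.
have ht' i : B i = cpoint c (t i, false).
  by apply/eqP; rewrite -edistance_eq0; apply/eqP/ht.
split=> [i|P Pe PB p /codomP[j ->]/=].
  exists (cpoint c (t i, false), cpoint c (t i, true)) => //.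
  exact: codom_f.
have Pj l : P (cpoint c (l, false)) <-> P (cpoint c (l, true)).
  by apply: (Pe (cpoint c (l, false), cpoint c (l, true))); exact: codom_f.
suff : (j, false) \in finset (fun v => `[< P (cpoint c v) >]).
  by rewrite finset.in_set => /asboolP.
apply: good => [l|q /hC' qE|]; rewrite !finset.in_set.
- exact: asbool_equiv_eq.
- by rewrite qE.
- by apply/asboolP; rewrite -ht'.
Qed.

End Configurations.

(** Since clamping to a box that contains the terminals neither breaks a
    spanning family nor lengthens it, only the compact set of configurations in
    that box matters; there spanning is a closed condition, being a finite
    disjunction of coincidence patterns. *)
Lemma min_spanning_exists (m : nat) :
  (exists2 es, (size es <= m)%N & spanning B i0 es) ->
  exists2 es0, spanning B i0 es0 & forall es, (size es <= m)%N ->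
    spanning B i0 es -> cost es0 <= cost es.
Proof.
move=> [es1 es1m es1B].
pose M : R := \sum_i \sum_j `|B i 0 j|.
have M0 : 0 <= M by apply: sumr_ge0 => i _; apply: sumr_ge0.
have BM i : clamp M (B i) = B i.
  apply: clamp_id => j; rewrite /M (bigD1 i)//= (bigD1 j)//= -addrA lerDl.
  by rewrite addr_ge0//; do 2?apply: sumr_ge0 => ? _ //; apply: sumr_ge0.
pose F := \bigcup_(q in [set q | good_pattern q]) @follows m q.
pose box := [set c : 'rV[R]_#|{: 'I_m * bool * 'I_d}| |
  forall k, `[- M, M]%classic (c 0 k)].
have cK : compact (F `&` box).
  have cbox : compact box.
    apply: (@rV_compact R _ (fun=> `[- M, M]%classic)) => k.
    exact: segment_compact.
  apply: (subclosed_compact _ cbox); last by move=> c [].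
  apply: closedI; last exact: compact_closed.
  apply: closed_bigcup => [|q _]; last exact: closed_follows.
  exact: (@finite_finset (pattern m)).

have toK es : (size es <= m)%N -> spanning B i0 es ->
    exists2 c, (F `&` box) c & cost (csegments c) <= cost es.
  move=> esm esB; have [es'B es'c] := spanning_pad esm esB.
  pose f (j : 'I_m) := let p := nth (B i0, B i0) es j in (clamp M p.1, clamp M p.2).
  have [c cf] := csegments_surj f.
  have csE : csegments c = [seq (clamp M p.1, clamp M p.2) | p <-
      [seq nth (B i0, B i0) es j | j : 'I_m]].
    rewrite -map_comp; apply: eq_map => j /=.
    by have [-> ->] := cf j.
  exists c; last first.
    rewrite -es'c csE /cost big_map; apply: ler_sum => p _ /=.
    exact: clamp_edistance_le.
  split.
    have /spanning_csegments[q gq fq] : spanning B i0 (csegments c).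
      by rewrite csE; exact: spanning_map.
    by exists q.
  move=> k; rewrite -(enum_valK k); case: (enum_val k) => -[j b] l.
  have -> : c 0 (enum_rank (j, b, l)) = cpoint c (j, b) 0 l by rewrite mxE.
  have [h1 h2] := cf j.
  by case: b; rewrite ?h1 ?h2 /f/= mxE /= in_itv/= le_max lexx/= ge_max ge_min
    lexx ?andbT /=; lra.
have [c1 Kc1 _] := toK _ es1m es1B.
have [c] := compact_EVT_min (ex_intro _ c1 Kc1) cK
  (continuous_subspaceT (@cost_continuous m)).
rewrite inE => -[[q gq fq] _] cmin.
exists (csegments c); first by apply/spanning_csegments; exists q.
move=> es esm esB; have [c' Kc' c'es] := toK _ esm esB.
by apply: le_trans c'es; apply: cmin; rewrite inE.
Qed.

Lemma connected_spanning es : spanning B i0 es ->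
  connected (\bigcup_(p in [set p | p \in es]) segment p.1 p.2).
Proof.
move=> [heads lnk]; set T := \bigcup_(p in _) _.
have TB : T (B i0).
  by have [p pes <-] := heads i0; exists p => //; exact: segmentl.
suff -> : T = connected_component T (B i0) by exact: component_connected.
apply/seteqP; split; last exact: connected_component_sub.
have seg p x y : p \in es -> segment p.1 p.2 x -> segment p.1 p.2 y ->
    connected_component T x y.
  move=> pes px py; exists (segment p.1 p.2) => //; split => //.
    by move=> z pz; exists p.
  exact: connected_seg.
move=> x [p /= pes px].
apply: (@connected_component_trans _ _ p.1); last first.
  by apply: (seg p) => //; exact: segmentl.
apply: (lnk (connected_component T (B i0))) => //; last first.
  exact: connected_component_refl.
move=> q qes; split=> h; apply: connected_component_trans h _;
  by apply: (seg q) => //; (exact: segmentl || exact: segmentr).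
Qed.

(** The union of a shortest spanning family of boundedly many segments is a
    Steiner tree, since a connected set through the terminals that is shorter
    than this union would yield a shorter family. *)
Lemma steiner_tree_exists : exists S, steiner_tree B S.
Proof.
pose m := (2 * n.+1)%N.
have [|es0 [heads lnk] emin] := @min_spanning_exists m.
  exists [seq (B i, B i0) | i : 'I_n].
    by rewrite size_map size_enum_ord /m; lia.
  split=> [i|P Pes PB _ /codomP[i ->]/=].
    by exists (B i, B i0) => //; exact: codom_f.
  by apply/(Pes (B i, B i0)) => //; exact: codom_f.
exists (\bigcup_(p in [set p | p \in es0]) segment p.1 p.2); split.
- by apply: connected_spanning; split.
- by move=> _ [i _ <-]; have [p pes <-] := heads i; exists p => //; exact: segmentl.
move=> T connT BT.
apply: (@le_trans _ _ (cost es0)%:E).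
  rewrite /cost (big_nth (B i0, B i0)) big_mkord.
  apply: (hausdorff1_segments_le (x := fun j : 'I_(size es0) => (nth (B i0, B i0) es0 j).1)
   (y := fun j : 'I_(size es0) => (nth (B i0, B i0) es0 j).2)).
  move=> x [p /= pes px].
  have pj : (index p es0 < size es0)%N by rewrite index_mem.
  by exists (Ordinal pj) => //=; rewrite nth_index.
have := hausdorff1_ge0 T.
case hE: (hausdorff1 T) => [h| |]// _; last by rewrite leey.
rewrite lee_fin; apply/ler_addgt0Pr => e e0.
have [|es [sz ce esB]] := spanning_le_hausdorff1 i0 connT BT (c := h) _ e0.
  by rewrite hE.
exact: le_trans (emin _ sz esB) ce.
Qed.

End Existence.

(** * Length of an embedded graph and its gradient *)

Lemma compact_bigcup_fin (X : topologicalType) (I : finType) (P : set I)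
  (F : I -> set X) : (forall i, P i -> compact (F i)) ->
  compact (\bigcup_(i in P) F i).
Proof.
move=> cF; rewrite -bigsetU_fset_set; last exact: finite_finset.
rewrite big_seq; apply: bigsetU_compact => i.
by rewrite in_fset_set ?inE; [exact: cF|exact: finite_finset].
Qed.

Section Graphs.
Variables (R : realType) (d : nat) (V : finType) (e : rel V).
Hypotheses (e_sym : symmetric e) (e_irr : irreflexive e).
Hypothesis (e_conn : forall u v, connect e u v).
Implicit Types (pos h : V -> 'rV[R]_d) (u v : V).

(** The double sum sees each edge once in either direction. No edge has to be
    oriented, which keeps summation by parts simple. *)
Definition graph_length pos : R :=
  2^-1 * \sum_u \sum_(v | e u v) edistance (pos u) (pos v).

(** The gradient of the length with respect to the position of [v]. *)
Definition vertex_gradient pos v : 'rV[R]_d := \sum_(u | e v u) udir (pos v - pos u).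

Definition oriented : {pred V * V} :=
  [pred p | e p.1 p.2 && (enum_rank p.1 < enum_rank p.2)%N].

Lemma sum_oriented (f : V -> V -> R) : (forall u v, f u v = f v u) ->
  2^-1 * (\sum_u \sum_(v | e u v) f u v) =
  \sum_(p in oriented) f p.1 p.2.
Proof.
move=> f_sym; rewrite pair_big_dep/=.
rewrite (bigID (fun p => (enum_rank p.1 < enum_rank p.2)%N))/=.
set s := \sum_(p in oriented) _; set s2 := \sum_(i | _) _.
suff -> : s2 = s by lra.
pose sw (p : V * V) := (p.2, p.1).
have sw_inj : injective sw by move=> [? ?] [? ?] [-> ->].
rewrite /s2 (reindex_inj sw_inj) /s.
apply: eq_big => [[u v]|[u v] _] /=; last exact: f_sym.
rewrite inE /= e_sym -leqNgt leq_eqVlt.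
have [uv|uv] := eqVneq u v; first by rewrite uv e_irr.
case: eqP => // /ord_inj/enum_rank_inj uv'.
by rewrite uv' eqxx in uv.
Qed.

Lemma graph_lengthE pos :
  graph_length pos = \sum_(p in oriented) edistance (pos p.1) (pos p.2).
Proof. by apply: sum_oriented => u v; exact: edistanceC. Qed.

(** Pairs that are not oriented edges get a trivial segment, which also takes
    care of isolated vertices. *)
Lemma hausdorff1_drawing_le pos :
  (hausdorff1 (drawing e pos) <= (graph_length pos)%:E)%E.
Proof.
pose y (p : V * V) := if p \in oriented then p.2 else p.1.
apply: le_trans (hausdorff1_segments_le (x := fun p => pos p.1)
  (y := fun p => pos (y p)) _) _.
  have or u v z : e u v -> (enum_rank u < enum_rank v)%N ->
      segment (pos u) (pos v) z ->
      (\bigcup_p segment (pos p.1) (pos (y p))) z.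
    by move=> euv uv zs; exists (u, v) => //=; rewrite /y inE /= euv uv.
  move=> z [[v _ <-]|[[u v] /= euv zs]].
    exists (v, v) => //=; rewrite /y inE /= e_irr; exact: segmentl.
  case: (ltngtP (enum_rank u) (enum_rank v)) => [uv|vu|/ord_inj/enum_rank_inj uv].
  - exact: or zs.
  - by apply: (or v u) => //; [rewrite e_sym|rewrite segmentC].
  - by rewrite uv e_irr in euv.
rewrite lee_fin graph_lengthE [leRHS]big_mkcond/=; apply: ler_sum => p _.
by rewrite /y; case: ifP; rewrite ?edistancexx.
Qed.

Lemma hausdorff1_drawing_ge pos : straight_embedding e pos ->
  ((graph_length pos)%:E <= hausdorff1 (drawing e pos))%E.
Proof.
move=> [pos_inj str]; rewrite graph_lengthE big_enum_val.
apply: (hausdorff1_segments_ge (x := fun i : 'I_#|oriented| => pos (enum_val i).1)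
  (y := fun i : 'I_#|oriented| => pos (enum_val i).2)).
  move=> i z zs; right; exists (enum_val i) => //.
  by case/andP : (enum_valP i).
move=> i j s t ij s01 t01; apply/eqP => st.
have /andP := enum_valP i; have /andP := enum_valP j.
case iE : (enum_val i) => [u v]; case jE : (enum_val j) => [a b] /=.
move=> [eab ab] [euv uv].
have npe : ~~ perm_eq [:: u; v] [:: a; b].
  apply/negP => pe; have uab : u \in [:: a; b] by rewrite -(perm_mem pe) mem_head.
  have vab : v \in [:: a; b] by rewrite -(perm_mem pe) !inE eqxx orbT.
  move: uab vab ij; rewrite !inE => /orP[]/eqP uE /orP[]/eqP vE.
  - by rewrite uE vE ltnn in uv.
  - by rewrite -(inj_eq enum_val_inj) iE jE uE vE eqxx.
  - by move: uv ab; rewrite uE vE => h1 h2; have := ltn_trans h1 h2; rewrite ltnn.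
  - by rewrite uE vE ltnn in uv.
have := str _ _ _ _ euv eab npe (line (pos u) (pos v) s).
case.
  split; first by apply: segment_line; lra.
  by move: st; rewrite iE jE /= => ->; apply: segment_line; lra.
move=> w /= /andP[wuv _] wE.
have uv' : pos v - pos u != 0.
  by rewrite subr_eq0; apply/eqP => /pos_inj vu; rewrite vu ltnn in uv.
move: wuv wE; rewrite !inE => /orP[]/eqP->; rewrite lineE.
  move=> /eqP; rewrite addrC -subr_eq subrr eq_sym scaler_eq0 (negPf uv') orbF.
  by move=> /eqP s0; move: s01; rewrite s0 ltxx.
move=> /eqP; rewrite addrC -subr_eq -{1}[pos v - pos u]scale1r -subr_eq0.
rewrite -scalerBl scaler_eq0 (negPf uv') orbF subr_eq0 => /eqP s1.
by move: s01; rewrite -s1 ltxx andbF.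
Qed.

Lemma drawing_connected pos : connected (drawing e pos).
Proof.
have [[v0 _]|V0] := pselect (exists v0 : V, True); last first.
  rewrite (_ : drawing e pos = set0); first exact: connected0.
  by apply/seteqP; split => // z [[v _ _]|[[v ?] _ _]]; case: V0; exists v.
set T := drawing e pos.
have Tv v : T (pos v) by left; exists v.
suff -> : T = connected_component T (pos v0) by exact: component_connected.
apply/seteqP; split; last exact: connected_component_sub.
have seg u v x y : e u v -> segment (pos u) (pos v) x ->
    segment (pos u) (pos v) y -> connected_component T x y.
  move=> uv px py; exists (segment (pos u) (pos v)) => //; split => //.
    by move=> z pz; right; exists (u, v).
  exact: connected_seg.
have Cv v : connected_component T (pos v0) (pos v).
  have /connectP[p ep ->] := e_conn v0 v.
  elim/last_ind: p ep => [_|p u IHp]; first exact: connected_component_refl.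
  rewrite rcons_path last_rcons => /andP[/IHp h eu].
  apply: connected_component_trans h _.
  by apply: (seg _ _ _ _ eu); [exact: segmentl|exact: segmentr].
move=> x [[v _ <-]//|[[u v] /= uv zs]].
apply: connected_component_trans (Cv u) _.
by apply: (seg _ _ _ _ uv) => //; exact: segmentl.
Qed.

Lemma drawing_compact pos : compact (drawing e pos).
Proof.
rewrite /drawing; apply: compactU.
  apply: finite_compact; exact: finite_image.
apply: compact_bigcup_fin => p _; exact: compact_seg.
Qed.

(** Summation by parts: the directions along an edge seen from its two ends are
    opposite. *)
Lemma sum_by_parts pos h :
  2^-1 * (\sum_u \sum_(v | e u v) dot (udir (pos u - pos v)) (h u - h v)) =
  \sum_v dot (vertex_gradient pos v) (h v).
Proof.
have eq1 : \sum_u \sum_(v | e u v) dot (udir (pos u - pos v)) (h u) =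
    \sum_v dot (vertex_gradient pos v) (h v).
  by apply: eq_bigr => u _; rewrite dot_suml.
have eq2 : \sum_u \sum_(v | e u v) dot (udir (pos u - pos v)) (h v) =
    - \sum_v dot (vertex_gradient pos v) (h v).
  rewrite (exchange_big_dep xpredT)//= -sumrN; apply: eq_bigr => v _.
  rewrite dot_suml -sumrN; apply: eq_big => [u|u _]; first by rewrite e_sym.
  by rewrite -dotNl -udirN opprB.
rewrite (eq_bigr (fun u => \sum_(v | e u v) dot (udir (pos u - pos v)) (h u) -
   \sum_(v | e u v) dot (udir (pos u - pos v)) (h v))); last first.
  by move=> u _; rewrite -sumrB; apply: eq_bigr => v _; rewrite dotBr.
rewrite sumrB eq1 eq2; lra.
Qed.

(** The length of an edge in its new position is at least its component along
    the old direction of the edge. *)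
Lemma graph_length_convex pos pos' :
  graph_length pos + \sum_v dot (vertex_gradient pos v) (pos' v - pos v) <=
  graph_length pos'.
Proof.
rewrite -(sum_by_parts pos (fun v => pos' v - pos v)) -mulrDr.
rewrite ler_wpM2l ?invr_ge0// -big_split; apply: ler_sum => u _ /=.
rewrite -big_split/=; apply: ler_sum => v _.
rewrite !edistanceE -(udir_dot (pos u - pos v)) -dotDr.
rewrite (_ : pos u - pos v + _ = pos' u - pos' v); first exact: udir_dot_le.
by apply/rowP => j; rewrite !mxE; ring.
Qed.

(** The tangent parabolas of the norm give, edge by edge, an upper bound that
    agrees to first order with the lower bound by convexity. *)
Lemma graph_length_smooth pos h : (forall u v, e u v -> pos u != pos v) ->
  exists C : R, forall t : R,
    graph_length (fun v => pos v + t *: h v) <=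
    graph_length pos + t * (\sum_v dot (vertex_gradient pos v) (h v)) + t ^+ 2 * C.
Proof.
move=> pos_neq.
pose c u v := dot (h u - h v) (h u - h v) / (2 * enorm (pos u - pos v)).
exists (2^-1 * \sum_u \sum_(v | e u v) c u v) => t.
rewrite -(sum_by_parts pos h) mulrCA [t ^+ 2 * _]mulrCA -!mulrDr.
rewrite ler_wpM2l ?invr_ge0// !mulr_sumr -!big_split; apply: ler_sum => u _ /=.
rewrite !mulr_sumr -!big_split/=; apply: ler_sum => v uv.
rewrite !edistanceE (_ : _ - _ = (pos u - pos v) + t *: (h u - h v)).
  by apply: enorm_tangent; rewrite subr_eq0 pos_neq.
by rewrite scalerBr opprD addrACA.
Qed.

End Graphs.

(** * The drawing determines the gradients *)

Section Directions.
Variables (R : realType) (d : nat).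
Variables (V : finType) (e : rel V) (pos : V -> 'rV[R]_d).
Hypotheses (e_sym : symmetric e) (e_irr : irreflexive e).
Hypotheses (e_conn : forall u v, connect e u v).
Hypothesis (str : straight_embedding e pos).

Let pos_inj : injective pos := str.1.

Lemma edge_neq u v : e u v -> pos v - pos u != 0.
Proof.
move=> uv; rewrite subr_eq0; apply/eqP => /pos_inj vu.
by rewrite vu e_irr in uv.
Qed.

(** Two edges leaving [v] in the same direction would share an initial
    segment. *)
Lemma directions_inj v :
  {in e v &, injective (fun u => udir (pos v - pos u))}.
Proof.
move=> u u' vu vu' /eqP; rewrite -[pos v - pos u]opprB -[pos v - pos u']opprB.
rewrite !udirN eqr_opp => /eqP dE; apply/eqP/negPn/negP => uu'.
have npe : ~~ perm_eq [:: v; u] [:: v; u'].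
  by rewrite perm_cons; apply/negP => /perm_mem/(_ u); rewrite !inE eqxx (negPf uu').
have lu : 0 < enorm (pos u - pos v) by rewrite enorm_gt0 edge_neq.
have lu' : 0 < enorm (pos u' - pos v) by rewrite enorm_gt0 edge_neq.
set l := enorm (pos u - pos v) in lu; set l' := enorm (pos u' - pos v) in lu'.
pose m := Num.min l l'; have m0 : 0 < m by rewrite lt_min lu.
have mE : line (pos v) (pos u) (m / l) = line (pos v) (pos u') (m / l').
  by rewrite !lineE -!scalerA -/(udir _) dE.
have [|w /= /andP[wu wu'] wE] := str.2 _ _ _ _ vu vu' npe (line (pos v) (pos u) (m / l)).
  split; last rewrite mE; apply: segment_line;
    by rewrite ler_pdivrMr// mul1r ge_min lexx ?orbT andbT divr_ge0// ltW.
have wv : w = v.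
  move: wu wu'; rewrite !inE => /orP[/eqP//|/eqP->] /orP[/eqP//|].
  by rewrite (negPf uu').
move/eqP: wE; rewrite wv lineE addrC -subr_eq subrr eq_sym scaler_eq0.
by rewrite (negPf (edge_neq vu)) orbF gt_eqF// divr_gt0.
Qed.

(** The other vertices and edges form a closed set. It misses the vertex [v]: an
    edge through [v] would meet an edge at [v] outside their common endpoints. *)
Lemma drawing_near_vertex v :
  \forall x \near pos v, drawing e pos x ->
    x = pos v \/ exists2 u, e v u & segment (pos v) (pos u) x.
Proof.
pose C := (\bigcup_(w in [set w | w != v]) [set pos w]) `|`
  \bigcup_(p in [set p : V * V | [&& e p.1 p.2, p.1 != v & p.2 != v]])
    segment (pos p.1) (pos p.2).
have cC : closed C.
  apply: compact_closed; first exact: norm_hausdorff.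
  apply: compactU; apply: compact_bigcup_fin => i _; last exact: compact_seg.
  exact: compact_set1.
have nCv : ~ C (pos v).
  move=> [[w /= wv /pos_inj vw]|[[x y] /= /and3P[exy xv yv] vxy]].
    by rewrite vw eqxx in wv.
  have /connectP[[|z p] /= ep lp] := e_conn v x; first by rewrite lp eqxx in xv.
  have /andP[vz _] := ep.
  have npe : ~~ perm_eq [:: v; z] [:: x; y].
    by apply/negP => /perm_mem/(_ v); rewrite !inE eqxx ![v == _]eq_sym (negPf xv) (negPf yv).
  have [|w /= /andP[wvz wxy] /pos_inj wv] := str.2 _ _ _ _ vz exy npe (pos v).
    by split; [exact: segmentl|].
  by move: wxy; rewrite wv !inE ![v == _]eq_sym (negPf xv) (negPf yv).
have : \forall x \near pos v, ~ C x.
  by apply: open_nbhs_nbhs; split => //; exact: closed_openC.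
apply: filterS => x nC [[w _ wx]|[[y z] /= yz xyz]].
  left; rewrite -wx; case: (eqVneq w v) => [->//|wv].
  by case: nC; left; exists w.
right; have [yv|yv] := eqVneq y v; first by exists z; rewrite -yv.
have [zv|zv] := eqVneq z v.
  by exists y; rewrite -zv; [rewrite e_sym|rewrite segmentC].
by case: nC; right; exists (y, z) => //=; rewrite yz yv zv.
Qed.
End Directions.

Section Uniqueness.
Variables (R : realType) (d : nat).
Variables (V V' : finType) (e : rel V) (e' : rel V').
Variables (pos : V -> 'rV[R]_d) (pos' : V' -> 'rV[R]_d).
Hypotheses (e_irr : irreflexive e).
Hypotheses (e'_sym : symmetric e') (e'_irr : irreflexive e').
Hypotheses (e'_conn : forall u v, connect e' u v).
Hypotheses (str : straight_embedding e pos) (str' : straight_embedding e' pos').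
Hypothesis same_drawing : drawing e pos `<=` drawing e' pos'.

(** Points of the edge from [v] to [u] that are close to [v] lie in the other
    drawing, hence on one of its edges at [v']. *)
Lemma direction_transfer v v' u : pos v = pos' v' -> e v u ->
  exists2 u', e' v' u' & udir (pos' v' - pos' u') = udir (pos v - pos u).
Proof.
move=> vv' vu.
have uv0 := edge_neq e_irr str vu.
have near0 := drawing_near_vertex e'_sym e'_conn str' v'.
have := @line_continuous R d (pos v) (pos u) 0.
rewrite -vv' in near0; rewrite /continuous_at line0 => /(_ _ near0) /nbhs_ballP[r /= r0 rP].
pose t := Num.min (r / 2) 1.
have t0 : 0 < t by rewrite lt_min ltr01 divr_gt0.
have t1 : t <= 1 by rewrite ge_min lexx orbT.
have tr : t < r.
  by apply: (@le_lt_trans _ _ (r / 2)); [rewrite ge_min lexx|lra].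
have [|||[u' vu' [s /= /andP[s0 s1] sE]]] := rP t.
- by rewrite /ball/= sub0r normrN gtr0_norm.
- apply: same_drawing; right; exists (v, u) => //.
  by apply: segment_line; rewrite ltW.
- move/eqP; rewrite lineE -subr_eq0 addrAC subrr add0r scaler_eq0.
  by rewrite (negPf uv0) orbF gt_eqF.
exists u' => //.
have tsE : s *: (pos' u' - pos' v') = t *: (pos u - pos v).
  by move: sE; rewrite -/(line _ _ _) !lineE vv' => /addrI.
have sn0 : s != 0.
  apply/eqP => s00; move: tsE; rewrite s00 scale0r => /esym/eqP.
  by rewrite scaler_eq0 (negPf uv0) orbF gt_eqF.
have sp : 0 < s by rewrite lt0r sn0.
by rewrite -opprB -[pos v - _]opprB !udirN -(udirZ _ sp) tsE udirZ.
Qed.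
End Uniqueness.

(** The gradient is minus the sum of the directions in which the drawing leaves
    the point. *)
Lemma vertex_gradient_unique (R : realType) (d : nat) (V V' : finType) (e : rel V)
    (e' : rel V') (pos : V -> 'rV[R]_d) (pos' : V' -> 'rV[R]_d) v v' :
  symmetric e -> irreflexive e -> (forall x y, connect e x y) ->
  straight_embedding e pos ->
  symmetric e' -> irreflexive e' -> (forall x y, connect e' x y) ->
  straight_embedding e' pos' ->
  drawing e pos = drawing e' pos' -> pos v = pos' v' ->
  vertex_gradient e pos v = vertex_gradient e' pos' v'.
Proof.
move=> s i c st s' i' c' st' dd' vv'.
rewrite /vertex_gradient -big_enum -[RHS]big_enum/=.
rewrite -(big_map (fun u => udir (pos v - pos u)) xpredT idfun).
rewrite -(big_map (fun u => udir (pos' v' - pos' u)) xpredT idfun)/=.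
apply: perm_big; apply: uniq_perm.
- by rewrite map_inj_in_uniq ?enum_uniq// => x y; rewrite !mem_enum;
    exact: directions_inj.
- by rewrite map_inj_in_uniq ?enum_uniq// => x y; rewrite !mem_enum;
    exact: directions_inj.
move=> z; apply/mapP/mapP => -[u]; rewrite mem_enum => vu ->.
  have [|u' vu' uE] := direction_transfer i s' c' st st' _ vv' vu.
    by rewrite dd'.
  by exists u' => //; rewrite mem_enum.
have [|u' vu' uE] := direction_transfer i' s c st' st _ (esym vv') vu.
  by rewrite dd'.
by exists u' => //; rewrite mem_enum.
Qed.

(** * Minimizers *)

(** At a Steiner point the unit vectors along the edges cancel: moving it
    against the gradient would otherwise shorten the tree to first order, and the
    tree would remain a connected set through the terminals. *)
Lemma vertex_gradient_steiner (R : realType) (d n : nat) (A : 'I_n -> 'rV[R]_d)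
    (S : set 'rV[R]_d) (G : labelled_graph n) (pos : vertex G -> 'rV[R]_d) v :
  steiner_tree A S -> represents A S pos ->
  (forall i, label G i <> v) -> vertex_gradient (@edge n G) pos v = 0.
Proof.
move=> [_ _ Smin] [[e_sym e_irr e_conn _] str SE labA _] nlab.
pose h u := if u == v then vertex_gradient (@edge n G) pos v else 0.
have [|C Cle] := @graph_length_smooth R d _ _ e_sym pos h.
  by move=> x y xy; rewrite eq_sym -subr_eq0; exact: edge_neq str _ _ xy.
have hsum : \sum_u dot (vertex_gradient (@edge n G) pos u) (h u) =
    dot (vertex_gradient (@edge n G) pos v) (vertex_gradient (@edge n G) pos v).
  rewrite (bigD1 v)//= /h eqxx big1 ?addr0// => u /negPf ->.
  by rewrite dotC dot0l.
apply/eqP; rewrite -dotxx_eq0; set g2 := dot _ _ in hsum *.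
have g20 : 0 <= g2 by exact: dotxx_ge0.
have key (t : R) : 0 < t -> t * g2 <= t ^+ 2 * C.
  move=> t0; pose pos' u := pos u + (- t) *: h u.
  have : (graph_length (@edge n G) pos <= graph_length (@edge n G) pos').
    rewrite -lee_fin; apply: le_trans (hausdorff1_drawing_ge e_sym e_irr str) _.
    apply: le_trans _ (hausdorff1_drawing_le e_sym e_irr pos'); rewrite -SE.
    apply: Smin; first exact: drawing_connected.
    move=> _ [i _ <-]; left; exists (label G i) => //.
    rewrite /pos' /h; case: eqP => [/nlab//|_].
    by rewrite scaler0 addr0 labA.
  by have := Cle (- t); rewrite -/pos' hsum sqrrN; lra.
apply/negPn/negP => gn0.
have gt0 : 0 < g2 by rewrite lt0r gn0.
have C1 : 0 < 2 * (1 + `|C|) by rewrite mulr_gt0// ltr_pwDl.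
pose t := g2 / (2 * (1 + `|C|)); have t0 : 0 < t by rewrite divr_gt0.
have := key t t0; rewrite expr2 -mulrA ler_pM2l//; apply/negP; rewrite -ltNge.
have : t * (2 * (1 + `|C|)) = g2 by rewrite divfK// gt_eqF.
have : t * C <= t * `|C| by rewrite ler_pM2l// ler_norm.
lra.
Qed.

Lemma chebyshev_dist_le (R : realType) (d n : nat) (A B : 'I_n -> 'rV[R]_d)
    (c : R) :
  0 <= c -> (forall i, edistance (A i) (B i) <= c) -> chebyshev_dist A B <= c.
Proof. by move=> c0 h; apply: bigmax_le. Qed.

Lemma nearest_point (R : realType) (d : nat) (y : 'rV[R]_d) (E : set 'rV[R]_d)
    (r : R) :
  compact E -> (dist_to_set y E <= r%:E)%E ->
  exists2 b, E b & edistance y b <= r.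
Proof.
move=> cE yE; have E0 : E !=set0.
  apply/set0P/eqP => E0; move: yE; rewrite /dist_to_set E0 image_set0 ereal_inf0.
  by rewrite leye_eq.
have [b] := compact_EVT_min E0 cE (continuous_subspaceT (@edistance_continuous R d y)).
rewrite inE => Eb bmin; exists b => //; rewrite -lee_fin; apply: le_trans yE.
apply: le_ereal_inf_tmp => _ [x Ex <-]; rewrite lee_fin.
by apply: bmin; rewrite inE.
Qed.

Theorem theorem2p12 (R : realType) (d n : nat) (A : 'I_n -> 'rV[R]_d)
    (S : set 'rV[R]_d) (r : R)
    (hS : steiner_tree A S)
    (r_gt0 : 0 < r)
    (htop : forall (B : 'I_n -> 'rV[R]_d) (T : set 'rV[R]_d),
        chebyshev_dist A B <= 2 * r -> steiner_tree B T ->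
        same_topology B T A S) :
  exists M : 'I_n -> 'rV[R]_d, r_minimizer r (range M) S.
Proof.
have [|G0 [_ [[pos0 rep0] _ _]]] := htop A S _ hS.
  by apply: chebyshev_dist_le => [|i]; rewrite ?edistancexx mulr_ge0// ltW.
have [[sym0 irr0 conn0 _] str0 SE0 lab0 _] := rep0.
have [Sconn AS Smin] := hS.
pose g i := vertex_gradient (@edge n G0) pos0 (label G0 i).
pose M i := A i + (r / enorm (g i)) *: g i.
have AM i : edistance (A i) (M i) <= r.
  rewrite edistanceE /M opprD addrA subrr add0r enormN enormZ normrM.
  rewrite (gtr0_norm r_gt0) normfV ger0_norm ?enorm_ge0// -mulrA.
  have [->|gn0] := eqVneq (enorm (g i)) 0; first by rewrite !mulr0 ltW.
  by rewrite mulVf ?mulr1.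
have gM i : dot (g i) (M i - A i) = r * enorm (g i).
  rewrite /M addrAC subrr add0r dotZr -enorm_sqr -mulrA.
  have [->|gn0] := eqVneq (enorm (g i)) 0; first by rewrite expr2 !mulr0.
  by rewrite expr2 mulKf.
exists M; split.
  split=> //; first by rewrite SE0; exact: drawing_compact.
  apply: ge_ereal_sup => _ [_ [i _ <-] <-].
  apply: ge_ereal_inf; exists (edistance (M i) (A i))%:E.
    by exists (A i) => //; apply: AS; exists i.
  by rewrite lee_fin edistanceC.
move=> E [Econn Ecomp EM].
have /choice[B BP] : forall i, exists b, E b /\ edistance (M i) b <= r.
  move=> i; have [|b Eb bM] := @nearest_point R d (M i) E r Ecomp.
    by apply: le_trans EM; apply: ereal_sup_ubound; exists (M i).
  by exists b.
have BE : range B `<=` E by move=> _ [i _ <-]; have [] := BP i.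
(* without terminals, [S] is minimal among all connected sets *)
have [[i0 _]|no_i] := pselect (exists i0 : 'I_n, True); last first.
  by apply: Smin => // z [i _ _]; case: no_i; exists i.
have [T hT] := steiner_tree_exists B i0.
have [|G [H [[posT repT] [posS repS] [f [f_bij f_edge f_lab]]]]] := htop B T _ hT.
  apply: chebyshev_dist_le => [|i]; first by rewrite mulr_ge0// ltW.
  have [_ MB] := BP i.
  apply: le_trans (edistance_triangle (M i) _ _) _.
  by have := AM i; lra.
have [[symT irrT connT _] strT TE labT _] := repT.
have [[symS irrS connS _] strS SE labS _] := repS.
have [f' fK f'K] := f_bij.
pose pos' v := posT (f' v).
have len_eq : graph_length (@edge n H) pos' = graph_length (@edge n G) posT.
  congr (_ * _); rewrite (reindex f); last by exists f' => ? _; rewrite ?fK ?f'K.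
  apply: eq_bigr => u _.
  rewrite (reindex f); last by exists f' => ? _; rewrite ?fK ?f'K.
  by apply: eq_big => [v|v _]; rewrite ?f_edge// /pos' !fK.
have gradB i : 0 <= dot (g i) (B i - A i).
  have -> : B i - A i = (M i - A i) - (M i - B i)
    by apply/rowP => j; rewrite !mxE; ring.
  rewrite dotBr gM subr_ge0 [leRHS]mulrC.
  apply: le_trans (dot_le _ _) _; rewrite ler_wpM2l ?enorm_ge0//.
  by rewrite -edistanceE; case: (BP i).
have len_le : graph_length (@edge n H) posS <= graph_length (@edge n H) pos'.
  apply: le_trans (graph_length_convex symS posS pos'); rewrite lerDl.
  apply: sumr_ge0 => v _.
  have [[i iv]|niv] := pselect (exists i, label H i = v); last first.
    rewrite (vertex_gradient_steiner hS repS) ?dot0l// => i iv.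
    by apply: niv; exists i.
  rewrite -iv labS /pos' -f_lab fK labT.
  rewrite (@vertex_gradient_unique R d _ _ _ (@edge n G0) posS pos0 _ (label G0 i)) //.
  - exact: gradB.
  - by rewrite -SE.
  - by rewrite f_lab labS.
apply: (@le_trans _ _ (graph_length (@edge n H) posS)%:E).
  by rewrite SE; exact: hausdorff1_drawing_le.
apply: (@le_trans _ _ (graph_length (@edge n G) posT)%:E).
  by rewrite lee_fin -len_eq.
apply: le_trans (hausdorff1_drawing_ge symT irrT strT) _; rewrite -TE.
by case: hT => _ _; apply.
Qed.
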